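(* Let $n,m,\hbar\in\mathbb{N}^+$, $A\in\mathbb{R}^{n\times n}$, $\{B_k\}_{k=1}^{\hbar}\subset\mathbb{R}^{n\times m}$ and $\Lambda_\hbar=\{t_j\}_{j\in\mathbb{N}}\in\mathfrak{I}_\hbar$ be given. For $\mathcal{Q}=(Q_j)_{j\in\mathbb{N}^+}\in\mathfrak{M}^n_{\hbar,+}$ and $\mathcal{R}=(R_j)_{j\in\mathbb{N}^+}\in\mathfrak{M}^m_{\hbar,+}$ consider the equation, with unknowns $P_0,\dots,P_\hbar$ that are real symmetric positive definite $n\times n$ matrices, $$\begin{cases} e^{-A^\top(t_{k+1}-t_k)}P_ke^{-A(t_{k+1}-t_k)}-P_{k+1}=Q_{k+1}-P_{k+1}B_{k+1}(R_{k+1}+B_{k+1}^\top P_{k+1}B_{k+1})^{-1}B_{k+1}^\top P_{k+1}, & 0\le k\le \hbar-1,\\ P_0=P_\hbar. \end{cases}\qquad (\mathrm{Ric}_{\mathcal{Q},\mathcal{R}})$$ The following statements are equivalent: (i) The system $(A,\{B_k\}_{k=1}^{\hbar},\Lambda_\hbar)$ is $\hbar$-stabilizable. (ii) For each $x_0\in\mathbb{R}^n$, the admissible set $\mathcal{U}_{ad}(x_0)$ is not empty. (iii) For any $\mathcal{Q}\in\mathfrak{M}^n_{\hbar,+}$ and $\mathcal{R}\in\mathfrak{M}^m_{\hbar,+}$, the equation $(\mathrm{Ric}_{\mathcal{Q},\mathcal{R}})$ has a unique solution $\{P_k\}_{k=0}^{\hbar}$. (iv) There are $\mathcal{Q}\in\mathfrak{M}^n_{\hbar,+}$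 and $\mathcal{R}\in\mathfrak{M}^m_{\hbar,+}$ such that the equation $(\mathrm{Ric}_{\mathcal{Q},\mathcal{R}})$ has a unique solution $\{P_k\}_{k=0}^{\hbar}$. Furthermore, if one of the equivalent conditions (i), (ii), (iii), (iv) is true, then for arbitrary $\mathcal{Q}\in\mathfrak{M}^n_{\hbar,+}$ and $\mathcal{R}\in\mathfrak{M}^m_{\hbar,+}$, with $\{P_k\}_{k=0}^{\hbar}$ the solution of $(\mathrm{Ric}_{\mathcal{Q},\mathcal{R}})$, the matrices $$F_k:=-\left(R_k+B_k^\top P_kB_k\right)^{-1}B_k^\top P_k,\qquad k=1,\dots,\hbar,$$ form a feedback law $\mathcal{F}=\{F_k\}_{k=1}^{\hbar}$ for which the closed-loop system $(A,\{B_kF_k\}_{k=1}^{\hbar},\Lambda_\hbar)$ is stable.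
   Context: $\mathbb{N}=\{0,1,2,\dots\}$, $\mathbb{N}^+=\{1,2,\dots\}$, $\mathbb{R}^+=[0,\infty)$; $l^2(\mathbb{R}^d)=l^2(\mathbb{N}^+;\mathbb{R}^d)$ and similarly for $l^\infty$. $\mathfrak{I}_\hbar$ is the set of all sequences $\Lambda_\hbar=\{t_j\}_{j\in\mathbb{N}}$ with $t_0=0<t_1<t_2<\cdots$ and $t_{j+\hbar}-t_j=t_\hbar$ for all $j\in\mathbb{N}^+$. For $s>0$ let $[s]:=\max\{k\in\mathbb{N}:k<s\}$, and for $j\in\mathbb{N}^+$ let $\vartheta(j):=j-[j/\hbar]\hbar\in\{1,\dots,\hbar\}$ (so $\vartheta(j+k\hbar)=j$ for $1\le j\le\hbar$, $k\in\mathbb{N}$). The system $(A,\{B_k\}_{k=1}^{\hbar},\Lambda_\hbar)$ is the impulse control system $$x'(t)=Ax(t),\ t\in\mathbb{R}^+\setminus\Lambda_\hbar;\qquad \triangle x(t_j)=B_{\vartheta(j)}u_j,\ j\in\mathbb{N}^+,$$ where $\triangle x(t_j):=x(t_j^+)-x(t_j)$ and $u=(u_j)_{j\in\mathbb{N}^+}\in l^2(\mathbb{R}^m)$. Solutions are left continuous on $\mathbb{R}^+$, continuous off $\{t_j\}_{j\in\mathbb{N}^+}$. The solution with $x(0)=x_0$ is $x(t;u,x_0)=e^{At}x_0+\sum_{0<t_j<t}e^{A(t-t_j)}B_{\vartheta(j)}u_j$. For $\mathcal{F}=\{F_k\}_{k=1}^{\hbar}\subset\mathbb{R}^{m\times n}$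 (a feedback law), the closed-loop system $(A,\{B_kF_k\}_{k=1}^{\hbar},\Lambda_\hbar)$ is $$x'(t)=Ax(t),\ t\in\mathbb{R}^+\setminus\Lambda_\hbar;\qquad \triangle x(t_j)=B_{\vartheta(j)}F_{\vartheta(j)}x(t_j),\ j\in\mathbb{N}^+.$$ It is stable if there are $M>0$, $\mu>0$ such that every solution satisfies $\|x(t)\|\le Me^{-\mu t}\|x(0)\|$ for all $t\in\mathbb{R}^+$. The system $(A,\{B_k\}_{k=1}^{\hbar},\Lambda_\hbar)$ is $\hbar$-stabilizable if there is a feedback law $\mathcal{F}$ for which the closed-loop system is stable. For $d\in\mathbb{N}^+$, $\mathfrak{M}^d_{\hbar,+}$ is the set of all sequences $(M_j)_{j\in\mathbb{N}^+}\in l^\infty(\mathbb{R}^{d\times d})$ with $M_{j+\hbar}=M_j$ for all $j\in\mathbb{N}^+$ and each $M_j$ symmetric and positive definite. $\mathcal{U}_{ad}(x_0):=\{u\in l^2(\mathbb{R}^m):(x(t_j;u,x_0))_{j\in\mathbb{N}^+}\in l^2(\mathbb{R}^n)\}$. *)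

(* Defs.v *)
From mathcomp Require Import all_boot all_order all_algebra.
From mathcomp Require Import all_classical all_reals all_analysis.

Set Implicit Arguments.
Unset Strict Implicit.
Unset Printing Implicit Defensive.

Import Order.TTheory GRing.Theory Num.Theory.
Import numFieldNormedType.Exports.

Local Open Scope classical_set_scope.
Local Open Scope ring_scope.

(* Sequences indexed by $\mathbb N^+$ and finite families indexed by
   $\{1, \dots, \hbar\}$ or $\{0, \dots, \hbar\}$ are functions on [nat]; no
   definition below depends on their values outside these index sets. *)

(* The Euclidean norm; the library norm on matrices is the sup norm. *)
Definition norm2 (K : realType) (d : nat) (x : 'cV[K]_d) : K :=
  Num.sqrt (\sum_(i < d) x i 0 ^+ 2).

Definition in_l2 (K : realType) (d : nat) (v : nat -> 'cV[K]_d) : Prop :=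
  cvgn (series (fun j => norm2 (v j.+1) ^+ 2)).

Definition in_linfty (K : realType) (d : nat) (M : nat -> 'M[K]_d) : Prop :=
  exists C : K, forall j, (0 < j)%N -> `|M j| <= C.

Definition expmx (K : realType) (n : nat) (A : 'M[K]_n) : 'M[K]_n :=
  limn (series (fun k => (k`!%:R : K)^-1 *: A ^+ k)).

Definition symposdef (K : realType) (d : nat) (M : 'M[K]_d) : Prop :=
  M^T = M /\ forall x : 'cV[K]_d, x != 0 -> 0 < (x^T *m M *m x) 0 0.

Definition impulse_times (K : realType) (h : nat) (t : nat -> K) : Prop :=
  [/\ t 0%N = 0,
      forall j, t j < t j.+1 &
      forall j, (0 < j)%N -> t (j + h)%N - t j = t h].

(* $[j/\hbar]$, where $[s]$ is the largest natural number strictly below $s$: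
   $k < j/\hbar$ iff $k\hbar < j$, and then $k < j$. *)
Definition strict_floor_div (j h : nat) : nat :=
  (\max_(k < j | k * h < j) k)%N.

Definition vartheta (h j : nat) : nat := (j - strict_floor_div j h * h)%N.

Lemma vartheta_addMl (h j k : nat) :
  (0 < j <= h)%N -> vartheta h (j + k * h) = j.
Proof.
move=> /andP[j0 jh]; rewrite /vartheta /strict_floor_div.
suff -> : (\max_(i < j + k * h | i * h < j + k * h) i)%N = k by rewrite addnK.
have h0 : (0 < h)%N by exact: leq_trans jh.
apply/eqP; rewrite eqn_leq; apply/andP; split.
  apply/bigmax_leqP => i; rewrite ltnNge => Hi; rewrite leqNgt.
  apply: contra Hi => ki.
  by rewrite (leq_trans _ (leq_mul ki (leqnn h)))// mulSn leq_add2r.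
have kj : (k < j + k * h)%N.
  by rewrite (leq_trans (n := (1 + k * h)%N))// ?leq_add2r// add1n ltnS leq_pmulr.
by apply: (leq_bigmax_cond (Ordinal kj)) => /=; rewrite -[ltnLHS]add0n ltn_add2r.
Qed.

(* Only the values of [x] on $\mathbb R^+$ matter. As $t_0 = 0$ belongs to
   $\Lambda_\hbar$, no equation is imposed at time $0$, where [x] is only
   required to be right continuous. The last clause is
   $\triangle x(t_j) = w_j$. *)
Definition impulse_solution (K : realType) (n : nat) (A : 'M[K]_n)
    (t : nat -> K) (w : nat -> 'cV[K]_n) (x : K -> 'cV[K]_n) : Prop :=
  [/\ forall s : K, 0 < s -> (forall j, s != t j) ->
        is_derive s (1 : K) x (A *m x s),
      forall s : K, 0 < s -> x r @[r --> s^'-] --> x s,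
      forall s : K, 0 <= s -> (forall j, (0 < j)%N -> s != t j) ->
        x r @[r --> s^'+] --> x s &
      forall j, (0 < j)%N -> x r @[r --> (t j)^'+] --> x (t j) + w j].

(* $x(s; u, x_0)$; the index set is finite for $s \ge 0$ because
   $t_j \to \infty$. *)
Definition state (K : realType) (n m h : nat) (A : 'M[K]_n)
    (B : nat -> 'M[K]_(n, m)) (t : nat -> K) (u : nat -> 'cV[K]_m)
    (x0 : 'cV[K]_n) (s : K) : 'cV[K]_n :=
  expmx (s *: A) *m x0 +
  \sum_(j \in [set j | (0 < j)%N /\ t j < s])
    expmx ((s - t j) *: A) *m (B (vartheta h j) *m u j).

Definition admissible (K : realType) (n m h : nat) (A : 'M[K]_n)
    (B : nat -> 'M[K]_(n, m)) (t : nat -> K) (x0 : 'cV[K]_n) :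
    set (nat -> 'cV[K]_m) :=
  [set u | in_l2 u /\ in_l2 (fun j => state h A B t u x0 (t j))].

Definition stable_system (K : realType) (n h : nat) (A : 'M[K]_n)
    (G : nat -> 'M[K]_n) (t : nat -> K) : Prop :=
  exists M mu : K, [/\ 0 < M, 0 < mu &
    forall x : K -> 'cV[K]_n,
      impulse_solution A t (fun j => G (vartheta h j) *m x (t j)) x ->
      forall s : K, 0 <= s -> norm2 (x s) <= M * expR (- mu * s) * norm2 (x 0)].

Definition closed_loop_stable (K : realType) (n m h : nat) (A : 'M[K]_n)
    (B : nat -> 'M[K]_(n, m)) (t : nat -> K) (F : nat -> 'M[K]_(m, n)) : Prop :=
  stable_system h A (fun k => B k *m F k) t.

Definition stabilizable (K : realType) (n m h : nat) (A : 'M[K]_n)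
    (B : nat -> 'M[K]_(n, m)) (t : nat -> K) : Prop :=
  exists F : nat -> 'M[K]_(m, n), closed_loop_stable h A B t F.

Definition periodic_weights (K : realType) (d h : nat) (M : nat -> 'M[K]_d) :
    Prop :=
  [/\ in_linfty M,
      forall j, (0 < j)%N -> M (j + h)%N = M j &
      forall j, (0 < j)%N -> symposdef (M j)].

Definition riccati_solution (K : realType) (n m h : nat) (A : 'M[K]_n)
    (B : nat -> 'M[K]_(n, m)) (t : nat -> K) (Q : nat -> 'M[K]_n)
    (R : nat -> 'M[K]_m) (P : nat -> 'M[K]_n) : Prop :=
  [/\ forall k, (k <= h)%N -> symposdef (P k),
      forall k, (k < h)%N ->
        expmx (- (t k.+1 - t k) *: A^T) *m P k *m
          expmx (- (t k.+1 - t k) *: A) - P k.+1 =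
        Q k.+1 - P k.+1 *m B k.+1 *m
          invmx (R k.+1 + (B k.+1)^T *m P k.+1 *m B k.+1) *m
          (B k.+1)^T *m P k.+1 &
      P 0%N = P h].

Definition riccati_unique_solution (K : realType) (n m h : nat) (A : 'M[K]_n)
    (B : nat -> 'M[K]_(n, m)) (t : nat -> K) (Q : nat -> 'M[K]_n)
    (R : nat -> 'M[K]_m) : Prop :=
  exists P, riccati_solution h A B t Q R P /\
    forall P', riccati_solution h A B t Q R P' ->
      forall k, (k <= h)%N -> P' k = P k.

Definition riccati_feedback (K : realType) (n m : nat)
    (B : nat -> 'M[K]_(n, m)) (R : nat -> 'M[K]_m) (P : nat -> 'M[K]_n)
    (k : nat) : 'M[K]_(m, n) :=
  - (invmx (R k + (B k)^T *m P k *m B k) *m (B k)^T *m P k).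

(* Main.v *)
Require Import Defs.
From mathcomp Require Import all_boot all_order all_algebra.
From mathcomp Require Import all_classical all_reals all_analysis.
From mathcomp Require Import ring lra.

Set Implicit Arguments.
Unset Strict Implicit.
Unset Printing Implicit Defensive.

Import Order.TTheory GRing.Theory Num.Theory.
Import numFieldNormedType.Exports.

Local Open Scope classical_set_scope.
Local Open Scope ring_scope.

(** Sampling the system just after the impulses turns it into a discrete-time
    system with $\hbar$-periodic coefficients: if $y_k = x(t_k^+)$, then
    $x(t_{k+1}) = E_k y_k$ with $E_k = e^{A(t_{k+1}-t_k)}$ invertible and
    $y_{k+1} = E_k y_k + B_{k+1} u_{k+1}$. In these terms the equation for $P_k$
    reads $P_k = \Phi_k(P_{k+1})$, where $y^\top\Phi_k(P)y$ is the minimum over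
    $u$ of
    $z^\top Q_{k+1}z + u^\top R_{k+1}u + (z+B_{k+1}u)^\top P(z+B_{k+1}u)$ with
    $z = E_k y$ ([riccati_map_square], [riccati_equation_dynprog]). It is the
    dynamic programming equation of a periodic linear-quadratic problem.

    A positive definite periodic solution $P$ is a Lyapunov function for the
    feedback that attains the minimum: each stage lowers $y^\top P_k y$ by at
    least $z^\top Q_{k+1} z$, which is at least a fixed fraction of it. So the
    sampled trajectory decays geometrically ([fixpoint_decay]), and the
    solution of the impulse system decays exponentially
    ([riccati_feedback_stable]). This is the last assertion of the theorem, and
    it shows that (iv) implies (i). The decay also gives uniqueness: along the
    feedback of a solution $P'$ the difference $y^\top(P_k-P'_k)y$ does not
    decrease, and its limit is not positive because the trajectory tends to zero
    ([fixpoint_le]).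

    A stabilizing feedback makes the sampled states square summable, so it
    generates an admissible control ([stabilizable_admissible]): (i) implies
    (ii). An admissible control has finite cost, so the minimal costs over the
    horizon $N$ are bounded in $N$; they are quadratic forms that increase with $N$, and
    their limit solves the equation ([fixpoint_exists]): (ii) implies (iii).
    Finally (iii) implies (iv) with identity weights.

    The passage between the two time scales rests on the uniqueness of
    solutions of $x' = Ax$ on an interval ([flow_unique]), obtained from the
    derivative of the matrix exponential. *)

(** * Bilinear and quadratic forms *)

Section BilinearForms.
Variables (K : realType) (d e : nat).
Implicit Types (M : 'M[K]_(d, e)) (x : 'cV[K]_d) (y : 'cV[K]_e).

(** The bilinear form $x^\top My$ of a rectangular matrix. *)
Definition bform M x y : K := (x^T *m M *m y) 0 0.

Lemma bform_tr M x y : bform M x y = (y^T *m M^T *m x) 0 0.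
Proof.
have -> : bform M x y = (x^T *m M *m y)^T 0 0 by rewrite mxE.
by rewrite !trmx_mul trmxK mulmxA.
Qed.

End BilinearForms.

Lemma bform_mulmxr (K : realType) (d e f : nat) (M : 'M[K]_(d, e))
    (N : 'M[K]_(e, f)) x y : bform M x (N *m y) = bform (M *m N) x y.
Proof. by rewrite /bform !mulmxA. Qed.

Lemma bform_mulmxl (K : realType) (d e f : nat) (M : 'M[K]_(d, e))
    (N : 'M[K]_(d, f)) x y : bform M (N *m x) y = bform (N^T *m M) x y.
Proof. by rewrite /bform trmx_mul !mulmxA. Qed.

Section QuadraticForms.
Variables (K : realType) (d : nat).
Implicit Types (M N : 'M[K]_d) (x y z : 'cV[K]_d).

(** The quadratic form $x^\top Mx$; with $M = 1$ it is the squared Euclidean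
    norm. *)
Definition qform M x : K := bform M x x.

Lemma bformDl M x y z : bform M (x + y) z = bform M x z + bform M y z.
Proof. by rewrite /bform linearD /= !mulmxDl mxE. Qed.

Lemma bformDr M x y z : bform M x (y + z) = bform M x y + bform M x z.
Proof. by rewrite /bform mulmxDr mxE. Qed.

Lemma bformZl M a x y : bform M (a *: x) y = a * bform M x y.
Proof. by rewrite /bform linearZ /= -!scalemxAl mxE. Qed.

Lemma bformZr M a x y : bform M x (a *: y) = a * bform M x y.
Proof. by rewrite /bform -scalemxAr mxE. Qed.

Lemma bformNl M x y : bform M (- x) y = - bform M x y.
Proof. by rewrite -scaleN1r bformZl mulN1r. Qed.

Lemma bformNr M x y : bform M x (- y) = - bform M x y.
Proof. by rewrite -scaleN1r bformZr mulN1r. Qed.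

Lemma bformC M x y : M^T = M -> bform M x y = bform M y x.
Proof. by move=> Ms; rewrite bform_tr Ms. Qed.

Lemma qformDm M N x : qform (M + N) x = qform M x + qform N x.
Proof. by rewrite /qform /bform mulmxDr mulmxDl mxE. Qed.

Lemma qformNm M x : qform (- M) x = - qform M x.
Proof. by rewrite /qform /bform mulmxN mulNmx mxE. Qed.

Lemma qform0 M : qform M 0 = 0.
Proof. by rewrite /qform /bform mulmx0 mxE. Qed.

Lemma qformD M x y : M^T = M ->
  qform M (x + y) = qform M x + 2 * bform M x y + qform M y.
Proof.
by move=> Ms; rewrite /qform bformDl !bformDr (bformC y x Ms); ring.
Qed.

Lemma qformB M x y : M^T = M ->
  qform M (x - y) = qform M x - 2 * bform M x y + qform M y.
Proof.
by move=> Ms; rewrite qformD// bformNr /qform bformNl bformNr; ring.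
Qed.

Lemma sqnormE x : norm2 x ^+ 2 = qform 1%:M x.
Proof.
rewrite /norm2 sqr_sqrtr ?sumr_ge0// => [|i _]; last exact: sqr_ge0.
rewrite /qform /bform mulmx1 mxE; apply: eq_bigr => i _.
by rewrite mxE expr2.
Qed.

Lemma bform_delta M i j : bform M (delta_mx i 0) (delta_mx j 0) = M i j.
Proof.
by rewrite /bform trmx_delta -rowE -colE !mxE.
Qed.

(** A symmetric matrix is determined by its quadratic form. *)
Lemma symmx_polarization M i j : M^T = M -> M i j =
  2^-1 * (qform M (delta_mx i 0 + delta_mx j 0) - qform M (delta_mx i 0) -
          qform M (delta_mx j 0)).
Proof. by move=> Ms; rewrite qformD// bform_delta; field. Qed.

Lemma qform_inj M N : M^T = M -> N^T = N -> qform M =1 qform N -> M = N.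
Proof.
move=> Ms Ns MN; apply/matrixP => i j.
by rewrite (symmx_polarization i j Ms) (symmx_polarization i j Ns) !MN.
Qed.

Lemma qform1_ge0 x : 0 <= qform 1%:M x.
Proof. by rewrite -sqnormE sqr_ge0. Qed.

Lemma qform1_eq0 x : (qform 1%:M x == 0) = (x == 0).
Proof.
apply/idP/eqP => [|->]; last by rewrite qform0.
rewrite /qform /bform mulmx1 mxE.
under eq_bigr do rewrite mxE -expr2.
rewrite psumr_eq0 => [/allP h|i _]; last exact: sqr_ge0.
apply/matrixP => i j; rewrite ord1 mxE; apply/eqP.
by rewrite -sqrf_eq0; apply: h; rewrite mem_index_enum.
Qed.

(** Symmetric positive semidefinite matrices. *)
Definition symsemidef M : Prop := M^T = M /\ forall x, 0 <= qform M x.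

Lemma symposdef_qform M x : symposdef M -> x != 0 -> 0 < qform M x.
Proof. by move=> [_]; apply. Qed.

Lemma symposdef_semidef M : symposdef M -> symsemidef M.
Proof.
move=> Mp; split=> [|x]; first by case: Mp.
by have [->|x0] := eqVneq x 0; rewrite ?qform0// ltW// symposdef_qform.
Qed.

Lemma symposdef_unit M : symposdef M -> M \in unitmx.
Proof.
move=> Mp; rewrite -row_free_unit -kermx_eq0; apply/rowV0P => v /sub_kermxP vM.
apply/eqP; rewrite -[v]trmxK -(inj_eq trmx_inj) trmxK trmx0.
apply/contraT => v0.
by have := symposdef_qform Mp v0; rewrite /qform /bform trmxK vM mul0mx mxE
  ltxx.
Qed.

Lemma cauchy_schwarz_qform M x y : symposdef M ->
  bform M x y ^+ 2 <= qform M x * qform M y.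
Proof.
move=> Mp; have [->|y0] := eqVneq y 0.
  by rewrite qform0 /bform mulmx0 mxE expr0n mulr0.
have Ms : M^T = M by case: Mp.
have := symposdef_qform Mp y0; set a := qform M y => a0.
(* The argument is $a$ times the component of $x$ that is orthogonal to $y$
   for the form of $M$. *)
have := (symposdef_semidef Mp).2 (a *: x - bform M x y *: y).
rewrite qformB// /qform !bformZl !bformZr -/(qform M y) -/(qform M x) -/a.
set b := bform M x y => h.
have : 0 <= a * (qform M x * a - b ^+ 2).
  by apply: le_trans h _; rewrite le_eqVlt; apply/orP; left; apply/eqP; ring.
by rewrite pmulr_rge0// subr_ge0.
Qed.

Lemma qform_le_sum M x :
  `|qform M x| <= (\sum_i \sum_j `|M i j|) * qform 1%:M x.
Proof.
have xS i : `|x i 0| <= Num.sqrt (qform 1%:M x).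
  rewrite -sqrtr_sqr ler_sqrt ?qform1_ge0// /qform /bform mulmx1 mxE.
  under [leRHS]eq_bigr do rewrite mxE -expr2.
  by rewrite (bigD1 i)//= lerDl sumr_ge0// => j _; rewrite sqr_ge0.
rewrite {1}/qform /bform mxE (le_trans (ler_norm_sum _ _ _))// mulr_suml.
under eq_bigr => i _ do rewrite mxE mulr_suml.
under [leRHS]eq_bigr => i _ do rewrite mulr_suml.
rewrite exchange_big /=; apply: ler_sum => i _.
rewrite (le_trans (ler_norm_sum _ _ _))//; apply: ler_sum => j _.
rewrite mxE normrM normrM -[qform _ _]sqr_sqrtr ?qform1_ge0//.
by rewrite mulrAC mulrC ler_wpM2l// expr2 ler_pM.
Qed.

Lemma qform_bounded M :
  exists2 C, 0 < C & forall x, qform M x <= C * qform 1%:M x.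
Proof.
exists (1 + \sum_i \sum_j `|M i j|) => [|x].
  by rewrite ltr_pwDl// sumr_ge0// => i _; rewrite sumr_ge0.
apply: le_trans (ler_norm _) _; apply: le_trans (qform_le_sum _ _) _.
by rewrite ler_wpM2r ?qform1_ge0// lerDr.
Qed.

(** Cauchy-Schwarz applied to $x$ and $M^{-1}x$. *)
Lemma symposdef_coercive M : symposdef M ->
  exists2 C, 0 < C & forall x, qform 1%:M x <= C * qform M x.
Proof.
move=> Mp; have [C C0 hC] := qform_bounded (invmx M).
exists C => // x; have Mu := symposdef_unit Mp.
have Ms : M^T = M by case: Mp.
have := cauchy_schwarz_qform x (invmx M *m x) Mp.
rewrite bform_mulmxr mulmxV// -/(qform 1%:M x).
rewrite /qform bform_mulmxr mulmxV// [bform 1%:M (_ *m _) _]bformC ?trmx1//.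
rewrite bform_mulmxr mul1mx -!/(qform _ _) => h.
have [->|x0] := eqVneq x 0; first by rewrite !qform0 mulr0.
have S0 : 0 < qform 1%:M x by rewrite lt_def qform1_eq0 x0 qform1_ge0.
rewrite -(ler_pM2r S0) -expr2 (le_trans h)// mulrAC mulrC.
by rewrite ler_wpM2r ?(symposdef_semidef Mp).2.
Qed.

End QuadraticForms.

Lemma qform_congr (K : realType) (d e : nat) (M : 'M[K]_d)
    (L : 'M[K]_(d, e)) x : qform (L^T *m M *m L) x = qform M (L *m x).
Proof. by rewrite /qform bform_mulmxr bform_mulmxl mulmxA. Qed.

(** * One stage of the Riccati recursion *)

Section RiccatiStep.
Variables (K : realType) (n m : nat).
Implicit Types (Q P : 'M[K]_n) (R : 'M[K]_m) (B : 'M[K]_(n, m)).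

(** For positive definite [R] and semidefinite [P], the form of
    [riccati_map Q R B P] at [z] is the minimum over [u] of the sum of the forms
    of [Q] at [z], of [R] at [u] and of [P] at [z + B *m u]; the minimum is
    attained at [riccati_gain R B P *m z]. *)
Definition riccati_map Q R B P : 'M[K]_n :=
  Q + P - P *m B *m invmx (R + B^T *m P *m B) *m B^T *m P.

Definition riccati_gain R B P : 'M[K]_(m, n) :=
  - (invmx (R + B^T *m P *m B) *m B^T *m P).

Lemma symposdef_riccati_weight R B P : symposdef R -> symsemidef P ->
  symposdef (R + B^T *m P *m B).
Proof.
move=> Rp Pp; split=> [|u u0].
  rewrite linearD /= !trmx_mul trmxK Pp.1.
  by have [-> _] := Rp; rewrite mulmxA.
rewrite -[ltRHS]/(qform _ u) qformDm ltr_pwDl//.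
  exact: symposdef_qform.
by rewrite qform_congr Pp.2.
Qed.

Lemma trmx_riccati_map Q R B P : Q^T = Q -> R^T = R -> P^T = P ->
  (riccati_map Q R B P)^T = riccati_map Q R B P.
Proof.
move=> Qs Rs Ps; rewrite /riccati_map !linearD linearN /= !trmx_mul.
rewrite trmxK trmx_inv linearD /= !trmx_mul trmxK Qs Rs Ps.
by rewrite !mulmxA.
Qed.

(** Completion of the square in the control variable. *)
Lemma riccati_map_square Q R B P z u : symposdef R -> symsemidef P ->
  qform Q z + qform R u + qform P (z + B *m u) =
  qform (riccati_map Q R B P) z +
  qform (R + B^T *m P *m B) (u - riccati_gain R B P *m z).
Proof.
move=> Rp Pp; have Sp := symposdef_riccati_weight B Rp Pp.
have Su := symposdef_unit Sp.
rewrite (qformD _ _ Pp.1) (qformB _ _ (proj1 Sp)) /riccati_map.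
rewrite /riccati_gain; set S := R + B^T *m P *m B.
have hS : qform S u = qform R u + qform P (B *m u).
  by rewrite /S qformDm qform_congr.
set G := invmx S *m B^T *m P.
have SG : S *m G = B^T *m P by rewrite /G !mulmxA mulmxV// mul1mx.
have h1 : bform S u ((- G) *m z) = - bform P z (B *m u).
  rewrite mulNmx bformNr (bform_mulmxr S) SG bform_tr trmx_mul trmxK.
  by rewrite Pp.1 bform_mulmxr.
have h2 : qform S ((- G) *m z) = qform (P *m B *m invmx S *m B^T *m P) z.
  rewrite mulNmx /qform bformNl bformNr opprK (bform_mulmxr S) SG bform_mulmxl.
  by rewrite /G !trmx_mul trmxK Pp.1 trmx_inv (proj1 Sp) !mulmxA.
by rewrite h1 h2 hS !qformDm qformNm; ring.
Qed.

Lemma riccati_map_le Q R B P z u : symposdef R -> symsemidef P ->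
  qform (riccati_map Q R B P) z <=
  qform Q z + qform R u + qform P (z + B *m u).
Proof.
move=> Rp Pp; rewrite riccati_map_square// lerDl.
exact: (symposdef_semidef (symposdef_riccati_weight B Rp Pp)).2.
Qed.

Lemma riccati_map_gain Q R B P z : symposdef R -> symsemidef P ->
  let u := riccati_gain R B P *m z in
  qform (riccati_map Q R B P) z =
  qform Q z + qform R u + qform P (z + B *m u).
Proof. by move=> Rp Pp u; rewrite riccati_map_square// subrr qform0 addr0. Qed.

Lemma riccati_map_mono Q R B P P' z :
  symposdef R -> symsemidef P -> symsemidef P' ->
  (forall x, qform P x <= qform P' x) ->
  qform (riccati_map Q R B P) z <= qform (riccati_map Q R B P') z.
Proof.
move=> Rp Pp P'p PP'; rewrite (riccati_map_gain Q B z Rp P'p).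
apply: le_trans (riccati_map_le Q B z (riccati_gain R B P' *m z) Rp Pp) _.
by rewrite lerD2l PP'.
Qed.

Lemma riccati_map_ge Q R B P z : symposdef R -> symsemidef P ->
  qform Q z <= qform (riccati_map Q R B P) z.
Proof.
move=> Rp Pp; rewrite riccati_map_gain// -addrA lerDl addr_ge0 ?Pp.2//.
exact: (symposdef_semidef Rp).2.
Qed.

End RiccatiStep.

(** * Convergence of matrices *)

Section MatrixConvergence.
Variables (K : realType) (T : Type) (F : set_system T).
Context {FF : Filter F}.

(** Convergence for the sup norm on matrices is entrywise convergence. *)
Lemma cvg_mxP m n (M_ : T -> 'M[K]_(m, n)) (L : 'M[K]_(m, n)) :
  M_ x @[x --> F] --> L <-> forall i j, M_ x i j @[x --> F] --> L i j.
Proof.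
split=> [ML i j|ML].
  by apply: (cvg_comp M_ (fun N : 'M[K]_(m, n) => N i j)) ML _;
    exact: coord_continuous.
apply/cvgrPdist_le => /= e e0; near=> x.
rewrite /Num.Def.normr/= mx_normrE (bigmax_le _ (ltW e0))//= => i _.
rewrite !mxE; move: i; near: x; apply: filter_forall => /= i.
exact: ((cvgrPdist_le _ _).1 (ML i.1 i.2)).
Unshelve. all: by end_near. Qed.

Lemma cvg_mulmx m n p (M_ : T -> 'M[K]_(m, n)) (N_ : T -> 'M[K]_(n, p))
    (L : 'M[K]_(m, n)) (L' : 'M[K]_(n, p)) :
  M_ x @[x --> F] --> L -> N_ x @[x --> F] --> L' ->
  M_ x *m N_ x @[x --> F] --> L *m L'.
Proof.
move=> /cvg_mxP ML /cvg_mxP NL; apply/cvg_mxP => i j; rewrite mxE.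
under eq_cvg do rewrite mxE.
by apply: cvg_big => [|k _]; [exact: add_continuous|exact: cvgM].
Qed.

Lemma cvg_trmx m n (M_ : T -> 'M[K]_(m, n)) (L : 'M[K]_(m, n)) :
  M_ x @[x --> F] --> L -> (M_ x)^T @[x --> F] --> L^T.
Proof.
move=> /cvg_mxP ML; apply/cvg_mxP => i j; rewrite mxE.
by under eq_cvg do rewrite mxE; exact: ML.
Qed.

Lemma cvg_det n (M_ : T -> 'M[K]_n) (L : 'M[K]_n) :
  M_ x @[x --> F] --> L -> \det (M_ x) @[x --> F] --> \det L.
Proof.
move=> /cvg_mxP ML; apply: cvg_big => [|s _]; first exact: add_continuous.
apply: cvgM; first exact: cvg_cst.
by apply: cvg_big => [|i _]; [exact: mul_continuous|exact: ML].
Qed.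

Lemma cvg_invmx n (M_ : T -> 'M[K]_n) (L : 'M[K]_n) :
  (forall x, M_ x \in unitmx) -> L \in unitmx -> M_ x @[x --> F] --> L ->
  invmx (M_ x) @[x --> F] --> invmx L.
Proof.
move=> Mu Lu ML; apply/cvg_mxP => i j.
have dL : \det L != 0 by rewrite -unitfE -unitmxE.
have invE (N : 'M[K]_n) : N \in unitmx ->
    invmx N i j = (\det N)^-1 * cofactor N j i.
  by move=> Nu; rewrite /invmx Nu !mxE.
rewrite invE//; under eq_cvg do rewrite invE//.
apply: cvgM; first by apply: cvgV => //; exact: cvg_det.
apply: cvgM; first exact: cvg_cst.
apply: cvg_det; apply/cvg_mxP => a b; rewrite mxE mxE.
by under eq_cvg do rewrite mxE mxE; move/cvg_mxP: ML; exact.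
Qed.

Lemma cvg_qform n (M_ : T -> 'M[K]_n) (L : 'M[K]_n) (x : 'cV[K]_n) :
  M_ t @[t --> F] --> L -> qform (M_ t) x @[t --> F] --> qform L x.
Proof.
move=> ML; have h : x^T *m M_ t *m x @[t --> F] --> x^T *m L *m x.
  by apply: cvg_mulmx; [apply: cvg_mulmx => //|]; exact: cvg_cst.
by move/cvg_mxP : h; exact.
Qed.

End MatrixConvergence.

(** A sequence of symmetric matrices whose quadratic forms are nondecreasing
    and bounded pointwise converges, by polarization. *)
Lemma cvgn_monotone_qform (K : realType) n (M_ : nat -> 'M[K]_n) :
  (forall N, symsemidef (M_ N)) ->
  (forall N x, qform (M_ N) x <= qform (M_ N.+1) x) ->
  (forall x, exists C, forall N, qform (M_ N) x <= C) ->
  exists2 L, symsemidef L & M_ N @[N --> \oo] --> L.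
Proof.
move=> Ms Mmono Mbd.
have nd x : {homo (fun N => qform (M_ N) x) : a b / (a <= b)%N >-> a <= b}.
  by apply: homo_leq => // a b c; exact: le_trans.
have cv x : cvgn (fun N => qform (M_ N) x).
  have [C hC] := Mbd x.
  by apply: nondecreasing_is_cvgn (nd x) _; exists C => _ [N _ <-].
have cvij i j : cvgn (fun N => M_ N i j).
  under eq_fun do rewrite (symmx_polarization i j (Ms _).1).
  by apply: is_cvgM; [exact: is_cvg_cst|apply: is_cvgB => //; exact: is_cvgB].
pose L := \matrix_(i, j) limn (fun N => M_ N i j).
have ML : M_ N @[N --> \oo] --> L 
  by apply/cvg_mxP => i j; rewrite mxE; exact: cvij.
exists L => //; split => [|x].
  suff MLT : M_ N @[N --> \oo] --> L^T.
    exact: (cvg_unique (@norm_hausdorff K _) MLT ML).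
  by under eq_cvg => N do rewrite -(Ms N).1; exact: cvg_trmx.
rewrite -(cvg_lim (@Rhausdorff K) (cvg_qform (x := x) ML)).
by apply: limr_ge => //; near=> N; exact: (Ms N).2.
Unshelve. all: by end_near. Qed.

(** * The periodic discrete-time problem *)

(** A bound that holds for each index of an [h]-periodic family, with a constant
    depending on the index, holds uniformly. *)
Lemma periodic_uniform_bound (K : realType) (h : nat) (Pr : nat -> K -> Prop) :
  (0 < h)%N ->
  (forall k, exists2 C, 0 < C & Pr k C) ->
  (forall k C C', Pr k C -> C <= C' -> Pr k C') ->
  (forall k C, Pr k C -> Pr (k + h)%N C) ->
  exists2 C, 0 < C & forall k, Pr k C.
Proof.
move=> h0 Prex Prmono Prper.
have [C C0 hC] : exists2 C, 0 < C & forall k, (k < h)%N -> Pr k C.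
  elim: {h0 Prper} h => [|N [C C0 hC]]; first by exists 1.
  have [C' C'0 hC'] := Prex N.
  exists (C + C') => [|k]; first exact: addr_gt0.
  rewrite ltnS leq_eqVlt => /predU1P[->|kN].
    by apply: Prmono hC' _; rewrite lerDr ltW.
  by apply: Prmono (hC _ kN) _; rewrite lerDl ltW.
exists C => // k; rewrite (divn_eq k h) addnC.
elim: (k %/ h)%N => [|q IH]; first by rewrite addn0; apply: hC; rewrite ltn_mod.
by rewrite mulSn addnCA addnC; exact: Prper.
Qed.

(** The sampled system moves from [y] to [E k *m y + B k *m u] at stage [k]; the
    cost is charged to the control [u] and to [E k *m y], the state just before
    the control acts. *)
Section PeriodicRiccati.
Variables (K : realType) (n m h : nat).
Variables (E : nat -> 'M[K]_n) (B : nat -> 'M[K]_(n, m)).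
Variables (Q : nat -> 'M[K]_n) (R : nat -> 'M[K]_m).
Hypothesis h_gt0 : (0 < h)%N.
Hypothesis E_unit : forall k, E k \in unitmx.
Hypothesis Q_posdef : forall k, symposdef (Q k).
Hypothesis R_posdef : forall k, symposdef (R k).
Hypothesis E_per : forall k, E (k + h)%N = E k.
Hypothesis B_per : forall k, B (k + h)%N = B k.
Hypothesis Q_per : forall k, Q (k + h)%N = Q k.
Hypothesis R_per : forall k, R (k + h)%N = R k.

(** The cost of stage [k]. *)
Definition stage_cost k (y : 'cV[K]_n) (u : 'cV[K]_m) : K :=
  qform (Q k) (E k *m y) + qform (R k) u.

(** The transition of stage [k]. *)
Definition step k (y : 'cV[K]_n) (u : 'cV[K]_m) : 'cV[K]_n :=
  E k *m y + B k *m u.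

(** The dynamic programming operator of stage [k] on quadratic forms. *)
Definition dynprog k (P : 'M[K]_n) : 'M[K]_n :=
  (E k)^T *m riccati_map (Q k) (R k) (B k) P *m E k.

(** The periodic positive definite solutions of the dynamic programming
    equation. *)
Definition periodic_fixpoint (P : nat -> 'M[K]_n) : Prop :=
  [/\ forall k, P (k + h)%N = P k, forall k, symposdef (P k) &
      forall k, P k = dynprog k (P k.+1)].

(** The control that attains the minimum in the dynamic programming equation
    for [P]. *)
Definition feedback (P : nat -> 'M[K]_n) k (y : 'cV[K]_n) : 'cV[K]_m :=
  riccati_gain (R k) (B k) (P k.+1) *m (E k *m y).

Lemma stage_cost_ge0 k y u : 0 <= stage_cost k y u.
Proof.
by rewrite addr_ge0//; apply: (proj2 (symposdef_semidef _)).
Qed.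

Lemma dynprog_le k P y u : symsemidef P ->
  qform (dynprog k P) y <= stage_cost k y u + qform P (step k y u).
Proof. by move=> Pp; rewrite qform_congr; exact: riccati_map_le. Qed.

Lemma dynprog_mono k P P' y : symsemidef P -> symsemidef P' ->
  (forall x, qform P x <= qform P' x) ->
  qform (dynprog k P) y <= qform (dynprog k P') y.
Proof. by move=> *; rewrite !qform_congr; exact: riccati_map_mono. Qed.

(** Positive definiteness comes from [Q]: the value is at least the cost of the
    state [E k *m y], which is not zero. *)
Lemma dynprog_posdef k P : symsemidef P -> symposdef (dynprog k P).
Proof.
move=> Pp; split.
  rewrite /dynprog !trmx_mul trmxK trmx_riccati_map ?mulmxA//.
  - exact: (Q_posdef k).1.
  - exact: (R_posdef k).1.
  - exact: Pp.1.
move=> y y0; rewrite -[ltRHS]/(qform _ y) qform_congr.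
apply: lt_le_trans (riccati_map_ge _ _ _ _ _) => //.
apply: symposdef_qform => //; apply: contra y0 => /eqP Ey.
by rewrite -(mulKmx (E_unit k) y) Ey mulmx0.
Qed.

Lemma fixpoint_feedback P k y : periodic_fixpoint P ->
  qform (P k) y = stage_cost k y (feedback P k y) +
                  qform (P k.+1) (step k y (feedback P k y)).
Proof.
move=> [_ Pp ->]; rewrite qform_congr; apply: riccati_map_gain => //.
exact: symposdef_semidef.
Qed.

(** [P] is a Lyapunov function for its own feedback: it loses at each step a
    fixed fraction of its value, because $Q$ is positive definite and $E$ is
    invertible. *)
Lemma fixpoint_decay P : periodic_fixpoint P ->
  exists C rho, [/\ 0 < C, 0 < rho < 1 &
    forall (y : nat -> 'cV[K]_n) k0,
      (forall j, y j.+1 = step (k0 + j) (y j) (feedback P (k0 + j) (y j))) ->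
      forall j, qform 1%:M (y j) <= C * rho ^+ j * qform 1%:M (y 0%N)].
Proof.
move=> PF; have [Pper Pp _] := PF.
have [c1 c10 hc1] : exists2 C, 0 < C &
    forall k y, qform (P k) y <= C * qform 1%:M y.
  apply: (periodic_uniform_bound h_gt0) => [k|k C C' hC CC' y|k C].
  - exact: qform_bounded.
  - by apply: le_trans (hC y) _; rewrite ler_wpM2r// qform1_ge0.
  - by rewrite Pper.
have [c2 c20 hc2] : exists2 C, 0 < C &
    forall k y, qform 1%:M y <= C * qform (P k) y.
  apply: (periodic_uniform_bound h_gt0) => [k|k C C' hC CC' y|k C].
  - exact: symposdef_coercive.
  - apply: le_trans (hC y) _.
    by rewrite ler_wpM2r// (symposdef_semidef (Pp k)).2.
  - by rewrite Pper.
have [c3 c30 hc3] : exists2 C, 0 < C &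
    forall k y, qform 1%:M y <= C * qform (Q k) (E k *m y).
  apply: (periodic_uniform_bound h_gt0) => [k|k C C' hC CC' y|k C].
  - have EQE : symposdef ((E k)^T *m Q k *m E k).
      split=> [|y y0]; first by rewrite !trmx_mul trmxK (Q_posdef k).1 mulmxA.
      rewrite -[ltRHS]/(qform _ y) qform_congr symposdef_qform//.
      apply: contra y0 => /eqP Ey.
      by rewrite -(mulKmx (E_unit k) y) Ey mulmx0.
    have [C C0 hC] := symposdef_coercive EQE; exists C => // y.
    by rewrite -qform_congr.
  - apply: le_trans (hC y) _; rewrite ler_wpM2r//.
    exact: (symposdef_semidef (Q_posdef k)).2.
  - by rewrite Q_per E_per.
(* [a] times the cost of a stage dominates the value, so a stage removes at
   least the fraction [a^-1] of the value; the summand [1] gives [a^-1 < 1]. *)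
pose a := 1 + c1 * c3.
have a1 : 1 < a by rewrite ltrDl mulr_gt0.
have a0 : 0 < a by exact: lt_trans a1.
exists (c2 * c1), (1 - a^-1); split; first exact: mulr_gt0.
  by rewrite subr_gt0 invf_lt1// a1/= gtrBl invr_gt0.
move=> y k0 hy j.
have step_decay i : qform (P (k0 + i.+1)%N) (y i.+1) <=
    (1 - a^-1) * qform (P (k0 + i)%N) (y i).
  rewrite addnS hy.
  have := fixpoint_feedback (k0 + i)%N (y i) PF.
  set u := feedback _ _ _; set W := qform (P (k0 + i)%N) _ => hW.
  have hQ : W <= a * qform (Q (k0 + i)%N) (E (k0 + i)%N *m y i).
    apply: le_trans (hc1 _ _) _; rewrite /a mulrDl mul1r.
    have Q0 := (symposdef_semidef (Q_posdef (k0 + i)%N)).2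
      (E (k0 + i)%N *m y i).
    by rewrite -[leLHS]add0r lerD// -mulrA ler_pM2l.
  have R0 := (symposdef_semidef (R_posdef (k0 + i)%N)).2 u.
  move: hQ; rewrite mulrC -ler_pdivrMr// mulrBl mul1r [_^-1 * _]mulrC => hQ.
  by move: hW; rewrite /stage_cost; lra.
have all_decay : qform (P (k0 + j)%N) (y j) <=
    (1 - a^-1) ^+ j * qform (P k0) (y 0%N).
  elim: j => [|j IH]; first by rewrite addn0 mul1r.
  apply: le_trans (step_decay j) _; rewrite exprS -mulrA ler_wpM2l//.
  by rewrite subr_ge0 invf_le1// ltW.
apply: le_trans (hc2 (k0 + j)%N _) _; rewrite -!mulrA ler_pM2l//.
apply: le_trans all_decay _; rewrite mulrCA ler_wpM2l//.
by rewrite exprn_ge0// subr_ge0 invf_le1// ltW.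
Qed.

(** The difference of two solutions does not decrease along the feedback of
    the second, while its first term tends to zero there. *)
Lemma fixpoint_le P P' k y : periodic_fixpoint P -> periodic_fixpoint P' ->
  qform (P k) y <= qform (P' k) y.
Proof.
move=> PF P'F; have [C [rho [C0 /andP[rho0 rho1] dec]]] := fixpoint_decay P'F.
have [Pper Pp Peq] := PF; have [_ P'p _] := P'F.
have [c c0 hc] : exists2 C, 0 < C &
    forall k y, qform (P k) y <= C * qform 1%:M y.
  apply: (periodic_uniform_bound h_gt0) => [i|i D D' hD DD' z|i D].
  - exact: qform_bounded.
  - by apply: le_trans (hD z) _; rewrite ler_wpM2r// qform1_ge0.
  - by rewrite Pper.
pose z := fix z j := if j is j'.+1 then
  step (k + j') (z j') (feedback P' (k + j') (z j')) else y.
have diff j : qform (P k) y - qform (P' k) y <=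
    qform (P (k + j)%N) (z j) - qform (P' (k + j)%N) (z j).
  elim: j => [|j IH]; first by rewrite addn0.
  apply: le_trans IH _; rewrite (fixpoint_feedback _ _ P'F) Peq addnS /=.
  set u := feedback _ _ _.
  have := dynprog_le (k + j)%N (z j) u (symposdef_semidef (Pp (k + j).+1)).
  lra.
have bnd j : qform (P k) y - qform (P' k) y <=
    geometric (c * C * qform 1%:M y) rho j.
  apply: le_trans (diff j) _; rewrite /geometric /=.
  rewrite (le_trans (y := qform (P (k + j)%N) (z j)))//.
    by rewrite gerBl; exact: (symposdef_semidef (P'p _)).2.
  apply: le_trans (hc _ _) _; rewrite -!mulrA ler_pM2l//.
  by rewrite [_ * rho ^+ j]mulrC mulrA; exact: (dec z k).
rewrite -subr_le0.
have rho_cvg : geometric (c * C * qform 1%:M y) rho j @[j --> \oo] --> (0 : K).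
  by apply: cvg_geometric; rewrite gtr0_norm.
rewrite -(cvg_lim (@Rhausdorff K) rho_cvg).
by apply: limr_ge; [apply/cvg_ex; exists 0|near=> j; exact: bnd].
Unshelve. all: by end_near. Qed.

Lemma fixpoint_unique P P' : periodic_fixpoint P -> periodic_fixpoint P' ->
  P =1 P'.
Proof.
move=> PF P'F k; have [_ Pp _] := PF; have [_ P'p _] := P'F.
apply: qform_inj; [exact: (Pp k).1|exact: (P'p k).1|] => x.
by apply/eqP; rewrite eq_le !fixpoint_le.
Qed.

(** The value at stage [k] of the problem with horizon [N]. *)
Fixpoint value_iter N k : 'M[K]_n :=
  if N is N'.+1 then dynprog k (value_iter N' k.+1) else 0.

Lemma symsemidef0 d : symsemidef (0 : 'M[K]_d).
Proof. by split=> [|x]; rewrite ?trmx0// /qform /bform mulmx0 mul0mx mxE. Qed.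

Lemma value_iter_semidef N k : symsemidef (value_iter N k).
Proof.
elim: N k => [|N IH] k; first exact: symsemidef0.
exact/symposdef_semidef/dynprog_posdef.
Qed.

Lemma value_iter_mono N k x :
  qform (value_iter N k) x <= qform (value_iter N.+1 k) x.
Proof.
elim: N k x => [|N IH] k x.
  rewrite [leLHS](_ : _ = 0); last by rewrite /qform /bform mulmx0 mul0mx mxE.
  exact: (value_iter_semidef 1 k).2.
apply: dynprog_mono; [exact: value_iter_semidef| |exact: IH].
exact: (value_iter_semidef N.+1).
Qed.

Lemma value_iter_per N k : value_iter N (k + h) = value_iter N k.
Proof.
elim: N k => [//|N IH] k /=.
by rewrite -addSn IH /dynprog E_per Q_per R_per B_per.
Qed.

Lemma value_iter_le_cost N k (y : nat -> 'cV[K]_n) (u : nat -> 'cV[K]_m) :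
  (forall j, y j.+1 = step (k + j) (y j) (u j)) ->
  qform (value_iter N k) (y 0%N) <= \sum_(j < N) stage_cost (k + j) (y j) (u j).
Proof.
elim: N k y u => [|N IH] k y u hy.
  by rewrite big_ord0 /qform /bform mulmx0 mul0mx mxE.
rewrite big_ord_recl /= addn0.
apply: le_trans (dynprog_le k (y 0%N) (u 0%N) (value_iter_semidef _ _)) _.
rewrite lerD2l; have := hy 0%N; rewrite addn0 => <-.
under eq_bigr do rewrite /bump add1n addnS -addSn.
by apply: (IH k.+1 (fun j => y j.+1) (fun j => u j.+1)) => j;
  rewrite hy addnS addSn.
Qed.

(** Each initial state at stage [0] has a control of finite total cost. *)
Definition finite_cost : Prop := forall x0, exists y u M,
  [/\ y 0%N = x0, forall j, y j.+1 = step j (y j) (u j) &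
      forall N, \sum_(j < N) stage_cost j (y j) (u j) <= M :> K].

(** The zero control from stage [k] to a later multiple of [h], followed by a
    control of finite cost, bounds the values at stage [k]. *)
Lemma value_iter_bounded k x : finite_cost ->
  exists C, forall N, qform (value_iter N k) x <= C.
Proof.
move=> fc; have per q : forall x, exists C, forall N,
    qform (value_iter N (q * h)) x <= C.
  move=> z; have [y [u [M [y0 hy hM]]]] := fc z; exists M => N.
  have -> : value_iter N (q * h) = value_iter N 0.
    by elim: q => [//|q <-]; rewrite mulSn addnC value_iter_per.
  by rewrite -y0; apply: le_trans (hM N); exact: value_iter_le_cost.
(* Backwards from the stage $kh \ge k$, which is a multiple of the period. *)
have : forall d x, (d <= k * h)%N -> exists C, forall N,
    qform (value_iter N (k * h - d)) x <= C.
  elim=> [|d IH] z dk; first by rewrite subn0.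
  have [C hC] := IH (E (k * h - d.+1)%N *m z) (ltnW dk).
  exists (stage_cost (k * h - d.+1) z 0 + C) => -[|N].
    rewrite [leLHS](_ : _ = 0); last by rewrite /qform /bform mulmx0 mul0mx mxE.
    rewrite addr_ge0 ?stage_cost_ge0//.
    by apply: le_trans (hC 0%N); exact: (value_iter_semidef 0 _).2.
  apply: le_trans (dynprog_le _ z 0 (value_iter_semidef _ _)) _.
  by rewrite lerD2l /step mulmx0 addr0 subnSK// hC.
move=> /(_ (k * h - k)%N x (leq_subr _ _)); rewrite subKn//.
by rewrite leq_pmulr.
Qed.

(** The values of the finite-horizon problems increase with the horizon and are
    bounded, so they converge, and the limit solves the equation because the
    dynamic programming operator is continuous. *)
Lemma fixpoint_exists : finite_cost -> exists P, periodic_fixpoint P.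
Proof.
move=> fc.
have /choice[P hP] k : exists L : 'M[K]_n,
    symsemidef L /\ value_iter N k @[N --> \oo] --> L.
  have [L Lp hL] := cvgn_monotone_qform (value_iter_semidef^~ k)
    (value_iter_mono^~ k) (fun x => value_iter_bounded k x fc).
  by exists L.
have PE k : P k = dynprog k (P k.+1).
  have h1 : value_iter N.+1 k @[N --> \oo] --> P k.
    by rewrite (cvg_shiftS (value_iter^~ k)); exact: (hP k).2.
  suff h2 : dynprog k (value_iter N k.+1) @[N --> \oo] --> dynprog k (P k.+1).
    exact: (cvg_unique (@norm_hausdorff K _) h1 h2).
  have hk := (hP k.+1).2.
  rewrite /dynprog /riccati_map.
  apply: cvg_mulmx; last exact: cvg_cst.
  apply: cvg_mulmx; first exact: cvg_cst.
  have PB : value_iter N k.+1 *m B k @[N --> \oo] --> P k.+1 *m B k.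
    by apply: cvg_mulmx => //; exact: cvg_cst.
  apply: cvgB; first by apply: cvgD => //; exact: cvg_cst.
  apply: cvg_mulmx => //; apply: cvg_mulmx; last exact: cvg_cst.
  apply: cvg_mulmx => //; apply: cvg_invmx => [N||].
  - exact/symposdef_unit/symposdef_riccati_weight/value_iter_semidef.
  - exact/symposdef_unit/symposdef_riccati_weight/(hP _).1.
  - apply: cvgD; first exact: cvg_cst.
    under eq_cvg do rewrite -mulmxA; rewrite -mulmxA.
    by apply: cvg_mulmx => //; exact: cvg_cst.
exists P; split=> [k|k|//].
  apply: (cvg_unique (@norm_hausdorff K _) _ (hP k).2).
  have := (hP (k + h)%N).2.
  by under [X in X @ _]eq_fun do rewrite value_iter_per.
by rewrite PE; apply: dynprog_posdef; exact: (hP _).1.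
Qed.

End PeriodicRiccati.

(** * The matrix exponential *)

Section MatrixDerivative.
Variable K : realType.

(** Differentiability of a matrix-valued function is entrywise. *)
Lemma is_derive_mxP m n (M : K -> 'M[K]_(m, n)) (s : K) D :
  is_derive s (1 : K) M D <->
  forall i j, is_derive s (1 : K) (fun r => M r i j) (D i j).
Proof.
split=> [[dM MD] i j|h].
  split; first exact: (derivable_mxP _ _ _).1.
  by rewrite -MD derive_mx// mxE.
have dM : derivable M s 1 by apply/derivable_mxP => i j; exact: ex_derive.
split=> //; rewrite derive_mx//; apply/matrixP => i j; rewrite mxE.
exact: derive_val.
Qed.

Lemma is_derive_mulmx m n p (M : K -> 'M[K]_(m, n)) (N : K -> 'M[K]_(n, p))
    (s : K) dM dN :
  is_derive s (1 : K) M dM -> is_derive s (1 : K) N dN ->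
  is_derive s (1 : K) (fun r => M r *m N r) (dM *m N s + M s *m dN).
Proof.
move=> /is_derive_mxP hM /is_derive_mxP hN; apply/is_derive_mxP => i j.
rewrite (_ : (fun _ => _) =
    \sum_(k < n) ((fun r => M r i k) * (fun r => N r k j))); last first.
  by apply/funext => r; rewrite mxE fct_sumE.
have hk k := is_deriveM (hM i k) (hN k j).
apply: is_derive_eq (is_derive_sum hk) _.
rewrite !mxE -big_split; apply: eq_bigr => k _ /=.
by rewrite addrC /GRing.scale /= [dM _ _ * _]mulrC.
Qed.

Lemma is_derive_continuous (V : normedModType K) (f : K -> V) (s : K) df :
  is_derive s (1 : K) f df -> f r @[r --> s] --> f s.
Proof.
move=> h; apply: differentiable_continuous; apply/derivable1_diffP.
exact: ex_derive.
Qed.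

Lemma is_derive0_constant_itv m n (M : K -> 'M[K]_(m, n)) (a b r s : K) :
  (forall c, a < c < b -> is_derive c (1 : K) M 0) ->
  a < r < b -> a < s < b -> M r = M s.
Proof.
move=> dM.
wlog rs : r s / r <= s => [hw|].
  by case: (leP r s) => rs hr hs; [exact: hw|apply/esym/hw => //; exact: ltW].
move=> /andP[ar rb] /andP[as_ sb].
have [->//|neq] := eqVneq r s; have {}rs : r < s by rewrite lt_neqAle neq rs.
have inab c : c \in `[r, s] -> a < c < b.
  by rewrite in_itv/= => /andP[rc cs]; rewrite (lt_le_trans ar)//
    (le_lt_trans cs).
have dij c i j : c \in `[r, s] -> is_derive c (1 : K) (fun x => M x i j) 0.
  by move=> /inab/dM/is_derive_mxP/(_ i j); rewrite mxE.
apply/matrixP => i j.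
have cont : {within `[r, s], continuous (fun x => M x i j)}.
  apply: derivable_within_continuous => c cs.
  exact: (@ex_derive _ _ _ _ _ _ _ (dij c i j cs)).
have dMij (x : K) : x \in `]r, s[ ->
    is_derive x (1 : K) (fun x => M x i j) ((fun=> 0) x).
  by move=> xrs; apply: dij; exact: subset_itv_oo_cc.
have [c _] := MVT rs dMij cont.
by rewrite mul0r => /eqP; rewrite subr_eq0 => /eqP.
Qed.

End MatrixDerivative.

Section MatrixExponential.
Variables (K : realType) (n : nat).
Implicit Types A M : 'M[K]_n.

Lemma exprZ_mx (s : K) A k : (s *: A) ^+ k = s ^+ k *: A ^+ k.
Proof.
elim: k => [|k IH]; first by rewrite !expr0 scale1r.
by rewrite !exprS IH -!mulmxE -scalemxAl -scalemxAr scalerA.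
Qed.

(** The entries of $Me^{sA}$ are power series in $s$ with these coefficients.
    The matrix $M$ makes the family stable under formal derivation, which
    replaces $M$ by $MA$. *)
Definition expmx_coeff A M i j : nat -> K :=
  fun k => (k`!%:R)^-1 * (M *m A ^+ k) i j.

Lemma pseries_diffs_expmx_coeff A M i j :
  pseries_diffs (expmx_coeff A M i j) = expmx_coeff A (M *m A) i j.
Proof.
apply/funext => k; rewrite /pseries_diffs /expmx_coeff factS natrM invfM.
rewrite !mulrA mulfV ?pnatr_eq0// mul1r exprS -mulmxE mulmxA//.
Qed.

Lemma expmx_coeff_cvg A M i j s : cvgn (pseries (expmx_coeff A M i j) s).
Proof.
pose a := \sum_i \sum_j `|A i j|.
pose b := \sum_i \sum_j `|M i j|.
have a0 : 0 <= a by apply: sumr_ge0 => *; exact: sumr_ge0.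
have rowa (N : 'M[K]_n) p : \sum_q `|N p q| <= \sum_i \sum_j `|N i j|.
  rewrite [leRHS](bigD1 p)//= lerDl; apply: sumr_ge0 => *; exact: sumr_ge0.
have bnd k p q : `|(M *m A ^+ k) p q| <= b * a ^+ k.
  elim: k q => [|k IH] q.
    rewrite expr0 mulr1 -[1]/(1%:M : 'M[K]_n) mulmx1.
    apply: le_trans (rowa M p); rewrite (bigD1 q)//= lerDl.
    exact: sumr_ge0.
  rewrite exprSr -mulmxE mulmxA mxE (le_trans (ler_norm_sum _ _ _))//.
  rewrite exprSr mulrA [leRHS]mulr_sumr; apply: ler_sum => l _.
  rewrite normrM; apply: ler_pM => //.
  by rewrite (bigD1 q)//= lerDl sumr_ge0.
apply: normed_cvg.
have := @is_cvg_seriesZ K (exp_coeff (a * `|s|)) b (is_cvg_series_exp_coeff _).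
apply: series_le_cvg => k //=.
  apply: mulr_ge0; first by apply: sumr_ge0 => *; exact: sumr_ge0.
  by rewrite exp_coeff_ge0// mulr_ge0.
rewrite /expmx_coeff /exp_coeff /= /GRing.scale /= !normrM normrX.
rewrite ger0_norm ?invr_ge0// exprMn mulrAC mulrC -mulrA [leRHS]mulrA.
by rewrite [X in _ * X]mulrC ler_wpM2r// mulr_ge0 ?invr_ge0// exprn_ge0.
Qed.

(** The partial sums of the series that defines $e^{sA}$. *)
Definition expmx_partial A s : nat -> 'M[K]_n :=
  series (fun k => (k`!%:R : K)^-1 *: (s *: A) ^+ k).

Lemma expmx_cvg A s : expmx_partial A s N @[N --> \oo] --> expmx (s *: A).
Proof.
suff h : cvgn (series (fun k => (k`!%:R : K)^-1 *: (s *: A) ^+ k)) by [].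
pose L := \matrix_(i, j) limn (pseries (expmx_coeff A 1%:M i j) s).
apply/cvg_ex; exists L; apply/cvg_mxP => i j; rewrite mxE.
rewrite (_ : (fun N => _) = pseries (expmx_coeff A 1%:M i j) s).
  exact: expmx_coeff_cvg.
apply/funext => N; rewrite /pseries /series /= summxE.
apply: eq_bigr => k _; rewrite mxE exprZ_mx mxE /expmx_coeff mul1mx.
by rewrite mulrCA mulrC.
Qed.

Lemma lim_pseries_expmx_coeff A M i j s :
  limn (pseries (expmx_coeff A M i j) s) = (M *m expmx (s *: A)) i j.
Proof.
apply: (cvg_lim (@Rhausdorff K)).
have /cvg_mxP/(_ i j) :
    M *m expmx_partial A s N @[N --> \oo] --> M *m expmx (s *: A).
  by apply: cvg_mulmx; [exact: cvg_cst|exact: expmx_cvg].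
rewrite (_ : (fun N => _) = pseries (expmx_coeff A M i j) s)//.
apply/funext => N; rewrite /pseries /expmx_partial /series /= mulmx_sumr summxE.
apply: eq_bigr => k _.
by rewrite exprZ_mx scalerA -scalemxAr mxE /expmx_coeff mulrAC.
Qed.

Lemma is_derive_expmx A (s : K) :
  is_derive s (1 : K) (fun r => expmx (r *: A)) (A *m expmx (s *: A)).
Proof.
apply/is_derive_mxP => i j; have pE M r := lim_pseries_expmx_coeff A M i j r.
under eq_fun do rewrite -[expmx _]mul1mx -pE.
rewrite -pE.
have -> : expmx_coeff A A i j = pseries_diffs (expmx_coeff A 1%:M i j).
  by rewrite pseries_diffs_expmx_coeff mul1mx.
apply: (@pseries_snd_diffs _ _ (`|s| + 1)); rewrite ?pseries_diffs_expmx_coeff.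
- exact: expmx_coeff_cvg.
- exact: expmx_coeff_cvg.
- exact: expmx_coeff_cvg.
- by rewrite [ltRHS]ger0_norm ?addr_ge0// ltrDl.
Qed.

Lemma expmx0 A : expmx (0 *: A) = 1%:M.
Proof.
apply/matrixP => i j; rewrite -[expmx _]mul1mx -lim_pseries_expmx_coeff.
apply: (cvg_lim (@Rhausdorff K)).
apply: cvg_near_cst; near=> N; rewrite /pseries /series /=.
have N0 : (0 < N)%N by near: N; exists 1%N.
rewrite -(prednK N0) big_nat_recl// big1 => [|k _].
  by rewrite /expmx_coeff fact0 invr1 mul1r mul1mx expr0 mulr1 addr0.
by rewrite expr0n mulr0.
Unshelve. all: by end_near. Qed.

Lemma expmx_comm A s : A *m expmx (s *: A) = expmx (s *: A) *m A.
Proof.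
have l : A *m expmx_partial A s N @[N --> \oo] --> A *m expmx (s *: A).
  by apply: cvg_mulmx; [exact: cvg_cst|exact: expmx_cvg].
suff r : A *m expmx_partial A s N @[N --> \oo] --> expmx (s *: A) *m A.
  exact: (cvg_unique (@norm_hausdorff K _) l r).
under eq_cvg => N.
  rewrite (_ : _ *m _ = expmx_partial A s N *m A); first over.
  rewrite /expmx_partial /series /= mulmx_sumr mulmx_suml.
  apply: eq_bigr => k _; rewrite exprZ_mx -!scalemxAr -!scalemxAl.
  by rewrite !mulmxE -exprS exprSr.
by apply: cvg_mulmx; [exact: expmx_cvg|exact: cvg_cst].
Qed.

Lemma trmx_expmx A s : (expmx (s *: A))^T = expmx (s *: A^T).
Proof.
have l : (expmx_partial A s N)^T @[N --> \oo] --> (expmx (s *: A))^T.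
  by apply: cvg_trmx; exact: expmx_cvg.
suff r : (expmx_partial A s N)^T @[N --> \oo] --> expmx (s *: A^T).
  exact: (cvg_unique (@norm_hausdorff K _) l r).
under eq_cvg => N.
  rewrite (_ : _^T = expmx_partial A^T s N); first over.
  rewrite /expmx_partial /series /= linear_sum.
  apply: eq_bigr => k _; rewrite !exprZ_mx !scalerA linearZ /=; congr (_ *: _).
  elim: k => [|k IH]; first by rewrite !expr0; exact: trmx1.
  by rewrite exprSr exprS -!mulmxE trmx_mul IH.
exact: expmx_cvg.
Qed.

(** $e^{-sA}e^{(s+r)A}$ has zero derivative in $s$. *)
Lemma expmxND A s r : expmx (s *: - A) *m expmx ((s + r) *: A) = expmx (r *: A).
Proof.
have dshift c : is_derive c (1 : K) (fun x => expmx ((x + r) *: A))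
    (A *m expmx ((c + r) *: A)).
  apply/is_derive_mxP => i j.
  have := is_derive_expmx A (c + r) => /is_derive_mxP/(_ i j) h.
  have hs : is_derive c (1 : K) (fun x => x + r) 1.
    have hD := is_deriveD (is_derive_id c (1 : K)) (is_derive_cst r c (1 : K)).
    by apply: is_derive_eq hD _; rewrite addr0.
  have hc := @is_derive1_comp K (fun x => expmx (x *: A) i j)
    (fun x => x + r) c _ _ h hs.
  by apply: is_derive_eq hc _; rewrite mulr1.
have dM c := is_derive_mulmx (is_derive_expmx (- A) c) (dshift c).
have dM0 c : is_derive c (1 : K)
    (fun s => expmx (s *: - A) *m expmx ((s + r) *: A)) 0.
  apply: is_derive_eq (dM c) _.
  by rewrite expmx_comm mulmxN mulNmx mulmxA addNr.
apply/matrixP => i j.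
rewrite -[in RHS](mul1mx (expmx _)) -(expmx0 (- A)) -[in RHS](add0r r).
apply: (@is_derive_0_is_cst _
  (fun x => (expmx (x *: - A) *m expmx ((x + r) *: A)) i j)).
by move=> c; have /is_derive_mxP/(_ i j) := dM0 c; rewrite mxE.
Qed.

Lemma expmxNK A s : expmx (s *: - A) *m expmx (s *: A) = 1%:M.
Proof. by have := expmxND A s 0; rewrite addr0 expmx0. Qed.

Lemma expmxKN A s : expmx (s *: A) *m expmx (s *: - A) = 1%:M.
Proof. by have := expmxNK (- A) s; rewrite opprK. Qed.

Lemma expmx_unit A s : expmx (s *: A) \in unitmx.
Proof. by have [] := mulmx1_unit (expmxNK A s). Qed.

Lemma expmxD A s r : expmx ((s + r) *: A) = expmx (s *: A) *m expmx (r *: A).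
Proof. by rewrite -(expmxND A s r) mulmxA expmxKN mul1mx. Qed.

Lemma expmx_continuous A (s : K) : expmx (r *: A) @[r --> s] --> expmx (s *: A).
Proof. exact: (is_derive_continuous (is_derive_expmx A s)). Qed.

End MatrixExponential.

(** * Solutions of the impulse system *)

Section ImpulseTimes.
Variables (K : realType) (h : nat) (t : nat -> K).
Hypotheses (h_gt0 : (0 < h)%N) (ht : impulse_times h t).

Lemma impulse_times_lt : {mono t : i j / (i < j)%N >-> i < j}.
Proof.
have [_ tS _] := ht; apply: leW_mono; apply: le_mono.
by apply: homo_ltn => //; exact: lt_trans.
Qed.

Lemma impulse_times_le : {mono t : i j / (i <= j)%N >-> i <= j}.
Proof. by apply: le_mono => i j; rewrite impulse_times_lt. Qed.

Lemma impulse_times_gap_gt0 k : 0 < t k.+1 - t k.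
Proof. by rewrite subr_gt0 impulse_times_lt. Qed.

Lemma impulse_times_gap_per k :
  t (k + h).+1 - t (k + h)%N = t k.+1 - t k.
Proof.
have [t0 _ tper] := ht.
have tp j : t (j + h)%N = t j + t h.
  by case: j => [|j]; rewrite ?t0 ?add0r// -(tper j.+1)// addrC subrK.
by rewrite -addSn !tp; ring.
Qed.

Lemma impulse_times_gap_le : exists2 tau, 0 < tau &
  forall k, t k.+1 - t k <= tau.
Proof.
apply: (periodic_uniform_bound h_gt0) => [k|k C C'|k C].
- by exists (t k.+1 - t k) => //; exact: impulse_times_gap_gt0.
- exact: le_trans.
- by rewrite impulse_times_gap_per.
Qed.

Lemma impulse_times_gap_ge : exists2 delta, 0 < delta &
  forall k, delta <= t k.+1 - t k.
Proof.
have [C C0 hC] : exists2 C, 0 < C & forall k, 1 <= C * (t k.+1 - t k).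
  apply: (periodic_uniform_bound h_gt0) => [k|k C C' hC CC'|k C].
  - exists (t k.+1 - t k)^-1; first by rewrite invr_gt0 impulse_times_gap_gt0.
    by rewrite mulVf// gt_eqF// impulse_times_gap_gt0.
  - by apply: le_trans hC _; rewrite ler_pM2r// impulse_times_gap_gt0.
  - by rewrite impulse_times_gap_per.
exists C^-1 => [|k]; first by rewrite invr_gt0.
by rewrite -[leLHS]mul1r ler_pdivrMr// mulrC.
Qed.

Lemma impulse_times_ge delta k :
  (forall k, delta <= t k.+1 - t k) -> delta * k%:R <= t k.
Proof.
have [t0 _ _] := ht; move=> hd; elim: k => [|k IH]; first by rewrite mulr0 t0.
by have := hd k; rewrite -natr1 mulrDr mulr1; lra.
Qed.

Lemma impulse_times_locate s : 0 < s -> exists j, t j < s <= t j.+1.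
Proof.
have [t0 _ _] := ht; move=> s0.
have [delta d0 hd] := impulse_times_gap_ge.
have /ex_minnP[N sN Nmin] : exists N, s <= t N.
  exists (Num.bound (s / delta)); apply: le_trans (impulse_times_ge _ hd).
  rewrite mulrC -ler_pdivrMr//; apply: ltW.
  by rewrite archi_boundP// divr_ge0// ltW.
case: N => [|N] in sN Nmin; first by move: sN; rewrite t0 leNgt s0.
exists N; rewrite sN andbT ltNge; apply/negP => /Nmin.
by rewrite ltnn.
Qed.

Lemma impulse_times_neq s j i : t j < s < t j.+1 -> s != t i.
Proof.
move=> /andP[js sj]; apply/eqP => si; move: js sj.
by rewrite si !impulse_times_lt ltnS => ji; rewrite leqNgt ji.
Qed.

End ImpulseTimes.

Section Flow.
Variables (K : realType) (n : nat) (A : 'M[K]_n).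

(** The solution of $x' = Ax$ with value [v] at time [a]. *)
Definition flow (a : K) (v : 'cV[K]_n) (s : K) : 'cV[K]_n :=
  expmx ((s - a) *: A) *m v.

Lemma flow_start a v : flow a v a = v.
Proof. by rewrite /flow subrr expmx0 mul1mx. Qed.

Lemma flow_continuous a v s : flow a v r @[r --> s] --> flow a v s.
Proof.
apply: cvg_mulmx; last exact: cvg_cst.
apply: (cvg_comp (fun r => r - a) (fun r => expmx (r *: A)));
  last exact: expmx_continuous.
by apply: cvgB; [exact: cvg_id|exact: cvg_cst].
Qed.

Lemma is_derive_flow a v s :
  is_derive s (1 : K) (flow a v) (A *m flow a v s).
Proof.
rewrite /flow; under eq_fun do rewrite expmxD -mulmxA.
rewrite expmxD -mulmxA.
have d := is_derive_mulmx (is_derive_expmx A s)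
  (is_derive_cst (expmx (- a *: A) *m v) s (1 : K)).
by apply: is_derive_eq d _; rewrite mulmx0 addr0 mulmxA.
Qed.

(** Uniqueness for $x' = Ax$ on an interval: $e^{-sA}x(s)$ is constant there,
    and the one-sided limits carry the value to the end points. *)
Lemma flow_unique (x : K -> 'cV[K]_n) (a b : K) v s :
  (forall c, a < c < b -> is_derive c (1 : K) x (A *m x c)) ->
  x r @[r --> a^'+] --> v ->
  x r @[r --> b^'-] --> x b ->
  a < s <= b -> x s = flow a v s.
Proof.
move=> dx xa xb.
pose g r := expmx (r *: - A) *m x r.
have dg c : a < c < b -> is_derive c (1 : K) g 0.
  move=> acb; have d := is_derive_mulmx (is_derive_expmx (- A) c) (dx c acb).
  apply: is_derive_eq d _.
  by rewrite expmx_comm mulmxN mulNmx mulmxA addNr.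
have gcst c : a < c < b -> g c = expmx (a *: - A) *m v.
  move=> acb; have ga : g r @[r --> a^'+] --> expmx (a *: - A) *m v.
    apply: cvg_mulmx xa; apply: cvg_at_right_filter; exact: expmx_continuous.
  suff ga' : g r @[r --> a^'+] --> g c.
    exact: (cvg_unique (@norm_hausdorff K _) ga' ga).
  have /andP[ac cb] := acb.
  apply: cvg_near_cst; near=> r; apply: (is_derive0_constant_itv dg _ acb).
  apply/andP; split.
    by near: r; exact: nbhs_right_gt.
  by near: r; apply: nbhs_right_lt; exact: lt_trans cb.
have inner c : a < c < b -> x c = flow a v c.
  move=> acb; rewrite /flow expmxD scaleNr -scalerN -mulmxA -(gcst c acb).
  by rewrite mulmxA expmxKN mul1mx.
case/andP=> as_; rewrite le_eqVlt => /predU1P[sb|sb]; last first.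
  by apply: inner; rewrite as_.
rewrite {s}sb in as_ *.
suff xb' : x r @[r --> b^'-] --> flow a v b.
  exact: (cvg_unique (@norm_hausdorff K _) xb xb').
have fb : flow a v r @[r --> b^'-] --> flow a v b.
  by apply: cvg_at_left_filter; exact: flow_continuous.
apply: cvg_trans fb; apply: near_eq_cvg; near=> r; apply/esym/inner.
apply/andP; split; near: r; first exact: nbhs_left_gt.
exact: nbhs_left_lt.
Unshelve. all: by end_near. Qed.

End Flow.

Section ImpulseSolutions.
Variables (K : realType) (n h : nat) (A : 'M[K]_n) (t : nat -> K).
Hypotheses (h_gt0 : (0 < h)%N) (ht : impulse_times h t).

(** The states just after the impulses: [post_jump x0 w j] is
    $x(t_j^+)$ for the jumps [w]. *)
Fixpoint post_jump (x0 : 'cV[K]_n) (w : nat -> 'cV[K]_n) j : 'cV[K]_n :=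
  if j is j'.+1 then flow A (t j') (post_jump x0 w j') (t j) + w j else x0.

(** Between two impulses a solution follows the flow from the state just after
    the first of them. *)
Lemma impulse_solution_flow w x : impulse_solution A t w x ->
  forall j s, t j < s <= t j.+1 ->
  x s = flow A (t j) (post_jump (x 0) w j) s.
Proof.
have [t0 tS _] := ht; have tlt := impulse_times_lt ht.
have tpos j : (0 < j)%N -> 0 < t j by move=> j0; rewrite -t0 tlt.
case=> dx xl xr xj j; elim: j => [|j IH] s sj.
  apply: flow_unique sj.
  - move=> c c01; apply: dx => [|i]; last exact: (impulse_times_neq ht _ c01).
    by have /andP[] := c01; rewrite t0.
  - by rewrite t0; apply: xr => // j j0; rewrite lt_eqF// tpos.
  - by apply: xl; exact: tpos.
apply: flow_unique sj.
- move=> c c01; apply: dx => [|i]; last exact: (impulse_times_neq ht _ c01).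
  by have /andP[c1 _] := c01; exact: lt_trans (tpos _ _) c1.
- by rewrite /= -IH ?lexx ?tS//; exact: xj.
- by apply: xl; exact: tpos.
Qed.

(** Conversely, a function that follows these flows is a solution. *)
Lemma flow_impulse_solution w (x : K -> 'cV[K]_n) :
  (forall j s, t j < s <= t j.+1 ->
    x s = flow A (t j) (post_jump (x 0) w j) s) ->
  impulse_solution A t w x.
Proof.
move=> xE; have [t0 tS _] := ht; have tlt := impulse_times_lt ht.
have right j : x r @[r --> (t j)^'+] --> post_jump (x 0) w j.
  have fl : flow A (t j) (post_jump (x 0) w j) r @[r --> (t j)^'+] -->
      post_jump (x 0) w j.
    rewrite -[X in _ --> X](flow_start A (t j)).
    by apply: cvg_at_right_filter; exact: flow_continuous.
  apply: cvg_trans fl; apply: near_eq_cvg; near=> r; apply/esym/xE.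
  apply/andP; split; near: r; first exact: nbhs_right_gt.
  exact: nbhs_right_le.
have inside s j : t j < s < t j.+1 ->
    \forall r \near s, flow A (t j) (post_jump (x 0) w j) r = x r.
  move=> /andP[js sj]; near=> r; apply/esym/xE; apply/andP; split.
    by near: r; exact: lt_nbhsr.
  by apply: ltW; near: r; exact: lt_nbhsl.
have locate s : 0 < s -> (forall j, (0 < j)%N -> s != t j) ->
    exists j, t j < s < t j.+1.
  move=> s0 sn; have [j /andP[js sj]] := impulse_times_locate h_gt0 ht s0.
  by exists j; rewrite js lt_neqAle sn.
split=> [s s0 sn|s s0|s s0 sn|[//|j] _].
- have [|j sj] := locate s s0; first by move=> j _; exact: sn.
  apply: near_eq_is_derive (inside _ _ sj) _.
  rewrite (xE j s); first exact: is_derive_flow.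
  by have /andP[-> /ltW] := sj.
- have [j sj] := impulse_times_locate h_gt0 ht s0.
  rewrite (xE j s)//.
  have fl : flow A (t j) (post_jump (x 0) w j) r @[r --> s^'-] -->
      flow A (t j) (post_jump (x 0) w j) s.
    by apply: cvg_at_left_filter; exact: flow_continuous.
  have /andP[js st] := sj.
  apply: cvg_trans fl; apply: near_eq_cvg; near=> r; apply/esym/xE.
  apply/andP; split.
    by near: r; exact: nbhs_left_gt.
  by apply: ltW; apply: lt_le_trans st; near: r; exact: nbhs_left_lt.
- move: s0; rewrite le_eqVlt => /predU1P[<-|s0].
    by rewrite -[in X in X^'+]t0; exact: (right 0%N).
  have [j sj] := locate s s0 sn.
  have fl : flow A (t j) (post_jump (x 0) w j) r @[r --> s] -->
      flow A (t j) (post_jump (x 0) w j) s by exact: flow_continuous.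
  rewrite (xE j s); last by have /andP[-> /ltW] := sj.
  apply: cvg_at_right_filter; apply: cvg_trans fl; apply: near_eq_cvg.
  exact: inside.
- rewrite (xE j (t j.+1)); last by rewrite tS lexx.
  exact: right.
Unshelve. all: by end_near. Qed.

Section ControlledState.
Variables (m : nat) (B : nat -> 'M[K]_(n, m)).
Variables (x0 : 'cV[K]_n) (u : nat -> 'cV[K]_m).

Let w j := B (vartheta h j) *m u j.

Lemma state0 : state h A B t u x0 0 = x0.
Proof.
have [t0 tS _] := ht; rewrite /state expmx0 mul1mx.
rewrite (_ : [set j | _] = set0) ?fsbig_set0 ?addr0//.
apply/seteqP; split=> // j [/= j0].
by rewrite ltNge ltW// -t0 (impulse_times_lt ht).
Qed.

(** The formula for the state: the term of the impulse at $t_j$ enters when $s$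
    passes $t_j$, and the terms before it are carried along by the flow. *)
Lemma state_flow j s : t j < s <= t j.+1 ->
  state h A B t u x0 s = flow A (t j) (post_jump x0 w j) s.
Proof.
move=> /andP[js sj]; have [t0 tS _] := ht; have tlt := impulse_times_lt ht.
rewrite /state (_ : [set i | _] = [set` iota 1 j]); last first.
  apply/seteqP; split=> i /=; rewrite mem_iota add1n ltnS.
    move=> [i0 is_]; rewrite i0/= -ltnS -tlt; exact: lt_le_trans is_ sj.
  move=> /andP[i0 ij]; split=> //; apply: le_lt_trans js.
  by rewrite (impulse_times_le ht).
rewrite -fsbig_seq ?iota_uniq//.
elim: j {js sj} => [|j IH].
  by rewrite big_nil addr0 /flow t0 subr0.
rewrite -[in iota 1 j.+1](addn1 j) iotaD big_cat /= add1n big_seq1 addrA IH.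
rewrite /flow mulmxDr [in RHS]mulmxA -expmxD.
by rewrite (_ : s - t j.+1 + (t j.+1 - t j) = s - t j)//; ring.
Qed.

Lemma state_impulse_solution : impulse_solution A t w (state h A B t u x0).
Proof.
by apply: flow_impulse_solution => j s sj; rewrite state0; exact: state_flow.
Qed.

End ControlledState.

End ImpulseSolutions.

(** * Stabilization and the Riccati equation *)

Lemma varthetaS (h k : nat) : (0 < h)%N -> vartheta h k.+1 = (k %% h).+1.
Proof.
move=> h0; rewrite [in LHS](divn_eq k h) addnC -addSn.
by rewrite vartheta_addMl// ltn_mod.
Qed.

Section ImpulseRiccati.
Variables (K : realType) (n m h : nat) (A : 'M[K]_n) (B : nat -> 'M[K]_(n, m)).
Variable t : nat -> K.
Hypotheses (h_gt0 : (0 < h)%N) (ht : impulse_times h t).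

(* The data of the sampled system; its stage [k] ends with the impulse at
   $t_{k+1}$, hence the shift of the indices. *)
Let E k := expmx ((t k.+1 - t k) *: A).
Let Bp k := B (vartheta h k.+1).

Let E_unit k : E k \in unitmx.
Proof. exact: expmx_unit. Qed.

Let E_per k : E (k + h)%N = E k.
Proof. by rewrite /E impulse_times_gap_per. Qed.

Let Bp_per k : Bp (k + h)%N = Bp k.
Proof. by rewrite /Bp !varthetaS// modnDr. Qed.

Lemma post_jumpS x0 w j :
  post_jump A t x0 w j.+1 = E j *m post_jump A t x0 w j + w j.+1.
Proof. by []. Qed.

Lemma periodic_weights_per d (M : nat -> 'M[K]_d) k :
  periodic_weights h M -> M (k + h).+1 = M k.+1.
Proof. by move=> [_ Mper _]; rewrite -addSn Mper. Qed.

Lemma periodic_weights_mod d (M : nat -> 'M[K]_d) k :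
  periodic_weights h M -> M (k %% h).+1 = M k.+1.
Proof.
move=> Mw; rewrite [in RHS](divn_eq k h) addnC.
elim: (k %/ h)%N => [|q IH]; first by rewrite addn0.
by rewrite IH mulSn addnCA [in RHS]addnC periodic_weights_per.
Qed.

(** The matrices $e^{sA}$ are uniformly bounded for $s$ in a bounded interval,
    so a decay of the states just after the impulses carries over to all
    times. *)
Lemma expmx_bounded tau : 0 <= tau -> exists2 D, 0 < D &
  forall s (v : 'cV[K]_n), 0 <= s <= tau ->
  qform 1%:M (expmx (s *: A) *m v) <= D * qform 1%:M v.
Proof.
move=> tau0; pose N s := (expmx (s *: A))^T *m 1%:M *m expmx (s *: A).
pose g s := \sum_i \sum_j `|N s i j|.
have cN s i j : N r i j @[r --> s] --> N s i j.
  suff cNs : N r @[r --> s] --> N s by move/cvg_mxP : cNs; exact.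
  apply: cvg_mulmx; last exact: expmx_continuous.
  apply: cvg_mulmx; last exact: cvg_cst.
  by apply: cvg_trmx; exact: expmx_continuous.
have cg : continuous g.
  move=> s; apply: cvg_big => [|i _]; first exact: add_continuous.
  apply: cvg_big => [|j _]; first exact: add_continuous.
  by apply: cvg_norm; exact: cN.
have [c _ gc] := EVT_max tau0 (continuous_subspaceT cg).
exists (1 + g c) => [|s v stau].
  by rewrite ltr_pwDl// sumr_ge0// => i _; rewrite sumr_ge0.
rewrite -qform_congr; apply: le_trans (ler_norm _) _.
apply: le_trans (qform_le_sum _ _) _; rewrite ler_wpM2r ?qform1_ge0//.
by rewrite ler_wpDl// -/(g s) gc// in_itv.
Qed.

Section Weights.
Variables (Q : nat -> 'M[K]_n) (R : nat -> 'M[K]_m).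
Hypotheses (Qw : periodic_weights h Q) (Rw : periodic_weights h R).

Let Qp k := Q k.+1.
Let Rp k := R k.+1.

Let Qp_posdef k : symposdef (Qp k).
Proof. by have [_ _] := Qw; exact. Qed.

Let Rp_posdef k : symposdef (Rp k).
Proof. by have [_ _] := Rw; exact. Qed.

Let Qp_per k : Qp (k + h)%N = Qp k.
Proof. exact: periodic_weights_per. Qed.

Let Rp_per k : Rp (k + h)%N = Rp k.
Proof. exact: periodic_weights_per. Qed.

Let fixpt := periodic_fixpoint h E Bp Qp Rp.

(** Multiplication by the transpose of $e^{A(t_{k+1}-t_k)}$ on the left and by
    this matrix on the right solves the equation for $P_k$. *)
Lemma riccati_equation_dynprog k (P P' : 'M[K]_n) (b : 'M[K]_(n, m))
    (r : 'M[K]_m) (q : 'M[K]_n) :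
  (expmx (- (t k.+1 - t k) *: A^T) *m P *m expmx (- (t k.+1 - t k) *: A) - P' =
   q - P' *m b *m invmx (r + b^T *m P' *m b) *m b^T *m P') <->
  P = (E k)^T *m riccati_map q r b P' *m E k.
Proof.
rewrite !scaleNr -!scalerN /riccati_map.
set d := t k.+1 - t k; set X := _ *m P'.
have ET : (E k)^T = expmx (d *: A^T) by rewrite /E trmx_expmx.
have KN := expmxKN A d; have NK := expmxNK A d.
have KNT := expmxKN A^T d; have NKT := expmxNK A^T d.
split=> [eq|->].
  have -> : q + P' - X = expmx (d *: - A^T) *m P *m expmx (d *: - A).
    by rewrite addrAC -eq subrK.
  rewrite ET /E -/d !mulmxA KNT mul1mx -!mulmxA NK.
  by rewrite mulmx1.
rewrite ET /E -/d -!mulmxA KN mulmx1 mulmxA NKT mul1mx.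
by rewrite addrAC addrK.
Qed.

(** Solutions of the equation, indexed by $0, \dots, \hbar$, and periodic
    solutions of the dynamic programming equation correspond to each other. *)
Lemma riccati_solution_fixpoint P : riccati_solution h A B t Q R P ->
  fixpt (fun k => P (k %% h)%N).
Proof.
move=> [Pp Peq P0h].
have PS k : P (k.+1 %% h)%N = P (k %% h).+1.
  have kh : (k %% h < h)%N by rewrite ltn_mod.
  rewrite -addn1 -modnDml addn1; move: kh; rewrite leq_eqVlt => /predU1P[->|kh].
    by rewrite modnn P0h.
  by rewrite modn_small.
split=> [k|k|k]; first by rewrite modnDr.
  by apply: Pp; rewrite ltnW// ltn_mod.
rewrite PS.
have kh : (k %% h < h)%N by rewrite ltn_mod.
have /riccati_equation_dynprog -> := Peq _ kh.
rewrite /dynprog /Bp varthetaS// /Qp /Rp.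
rewrite (periodic_weights_mod _ Qw) (periodic_weights_mod _ Rw).
suff -> : E (k %% h)%N = E k by [].
rewrite [in RHS](divn_eq k h) addnC.
elim: (k %/ h)%N => [|q IH]; first by rewrite addn0.
by rewrite IH mulSn addnCA [in RHS]addnC E_per.
Qed.

Lemma fixpoint_riccati_solution P : fixpt P -> riccati_solution h A B t Q R P.
Proof.
move=> [Pper Pp Peq]; split=> [k _|k kh|]; first exact: Pp.
  apply/riccati_equation_dynprog; rewrite {1}Peq /dynprog /Bp varthetaS//.
  by rewrite modn_small.
by rewrite -(Pper 0%N).
Qed.

Lemma riccati_unique : finite_cost E Bp Qp Rp ->
  riccati_unique_solution h A B t Q R.
Proof.
move=> fc; have [P PF] := fixpoint_exists h_gt0 E_unit Qp_posdef Rp_posdef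
  E_per Bp_per Qp_per Rp_per fc.
exists P; split=> [|P' P'sol k]; first exact: fixpoint_riccati_solution.
have P'F := riccati_solution_fixpoint P'sol.
have eqP := fixpoint_unique h_gt0 E_unit Qp_posdef Rp_posdef E_per Qp_per
  P'F PF.
rewrite leq_eqVlt => /predU1P[->|kh]; last by rewrite -eqP modn_small.
have [Pper _ _] := PF; have [_ _ P'0] := P'sol.
by rewrite -P'0 -[h]add0n Pper -eqP mod0n.
Qed.

(** The states just after the impulses form a trajectory of the sampled system
    under the feedback of [P], so they decay geometrically. *)
Lemma riccati_feedback_stable P : riccati_solution h A B t Q R P ->
  closed_loop_stable h A B t (riccati_feedback B R P).
Proof.
move=> Psol; have PF := riccati_solution_fixpoint Psol.
have [C [rho [C0 /andP[rho0 rho1] dec]]] :=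
  fixpoint_decay h_gt0 E_unit Qp_posdef Rp_posdef E_per Qp_per PF.
have [tau tau0 htau] := impulse_times_gap_le h_gt0 ht.
have [D D0 hD] := expmx_bounded (ltW tau0).
(* Up to a constant the squared norm decays by the factor [rho] on each gap,
   of length at most [tau], hence at least like $e^{-2\mu s}$. *)
pose mu := - ln rho / (2 * tau).
have mu0 : 0 < mu by rewrite divr_gt0 ?mulr_gt0// oppr_gt0 ln_lt0// rho0.
have DC0 : 0 < D * C / rho by rewrite divr_gt0// mulr_gt0.
(* The summand [1] makes the constant smaller than its square and covers
   time $0$. *)
exists (1 + D * C / rho), mu; split=> // [|x xsol s s0]; first exact: addr_gt0.
have xE := impulse_solution_flow ht xsol.
set w := (fun j => _) in xsol xE.
have yS j : post_jump A t (x 0) w j.+1 =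
    step E Bp (0 + j)%N (post_jump A t (x 0) w j)
      (feedback E Bp Rp (fun k => P (k %% h)%N) (0 + j)%N
        (post_jump A t (x 0) w j)).
  rewrite post_jumpS add0n /step; congr (_ + _).
  have [_ tS _] := ht; rewrite /w (xE j); last by rewrite tS lexx.
  rewrite -mulmxA /flow -/(E j) /feedback /riccati_gain /riccati_feedback.
  rewrite -/(Bp j); congr (_ *m (_ *m _)).
  have [Pp _ P0h] := Psol.
  have -> : P (j.+1 %% h)%N = P (vartheta h j.+1).
    rewrite varthetaS// -addn1 -modnDml addn1.
    have : (j %% h < h)%N by rewrite ltn_mod.
    rewrite leq_eqVlt => /predU1P[->|jh]; first by rewrite modnn P0h.
    by rewrite modn_small.
  suff -> : R (vartheta h j.+1) = Rp j by [].
  by rewrite varthetaS// periodic_weights_mod.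
have ydec j := dec (post_jump A t (x 0) w) 0%N yS j.
have sq : norm2 (x s) ^+ 2 <=
    ((1 + D * C / rho) * expR (- mu * s) * norm2 (x 0)) ^+ 2.
  rewrite !exprMn -expRM_natl !sqnormE.
  have M1 : 1 + D * C / rho <= (1 + D * C / rho) ^+ 2.
    by rewrite expr2 ler_peMr ?lerDl ?addr_ge0 ?(ltW DC0).
  move: s0; rewrite le_eqVlt => /predU1P[<-|s0].
    rewrite mulr0 mulr0 expR0 mulr1 ler_peMl ?qform1_ge0//.
    by apply: le_trans M1; rewrite lerDl ltW.
  have [j /andP[js sj]] := impulse_times_locate h_gt0 ht s0.
  rewrite (xE j) ?js//; apply: le_trans (hD _ _ _) _.
    by rewrite subr_ge0 ltW//=; apply: le_trans (htau j); rewrite lerD2r.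
  apply: le_trans (_ : D * (C * rho ^+ j * qform 1%:M (x 0)) <= _).
    by rewrite ler_pM2l//; exact: ydec.
  rewrite [leLHS]mulrA ler_wpM2r ?qform1_ge0// [leLHS]mulrA.
  have sle : s <= tau * j.+1%:R.
    apply: le_trans sj _; have [t0 _ _] := ht; elim: (j.+1) => [|i IH].
      by rewrite t0 mulr0.
    by have := htau i; rewrite -natr1 mulrDr mulr1; lra.
  have rhoj : rho ^+ j <= rho^-1 * expR (2%:R * (- mu * s)).
    rewrite ler_pdivlMl// -exprS.
    rewrite -[rho]lnK// -expRM_natl ler_expR.
    rewrite (_ : _ * ln rho = - (2 * mu) * (tau * j.+1%:R)); last first.
      by rewrite /mu; field; rewrite gt_eqF.
    rewrite (_ : 2%:R * (- mu * s) = - (2 * mu) * s); last by ring.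
    by rewrite ler_nM2l// oppr_lt0 mulr_gt0.
  apply: le_trans (_ : D * C * (rho^-1 * expR (2%:R * (- mu * s))) <= _).
    by rewrite ler_pM2l// mulr_gt0.
  rewrite [leLHS]mulrA ler_pM2r ?expR_gt0//.
  by apply: le_trans M1; rewrite lerDr.
rewrite -(ler_pXn2r (n := 2))// ?nnegrE ?sqrtr_ge0//.
by rewrite !mulr_ge0 ?sqrtr_ge0 ?expR_ge0// ltW// addr_gt0.
Qed.

(** The cost of an admissible control is bounded by a multiple of the squared
    $l^2$-norms of the control and of the sampled state. *)
Lemma admissible_finite_cost :
  (forall x0, admissible h A B t x0 !=set0) -> finite_cost E Bp Qp Rp.
Proof.
move=> adm x0; have [u [ul2 xl2]] := adm x0.
have [cQ cQ0 hQ] : exists2 C, 0 < C &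
    forall k x, qform (Qp k) x <= C * qform 1%:M x.
  apply: (periodic_uniform_bound h_gt0) => [k|k C C' hC CC' x|k C].
  - exact: qform_bounded.
  - by apply: le_trans (hC x) _; rewrite ler_wpM2r// qform1_ge0.
  - by rewrite Qp_per.
have [cR cR0 hR] : exists2 C, 0 < C &
    forall k x, qform (Rp k) x <= C * qform 1%:M x.
  apply: (periodic_uniform_bound h_gt0) => [k|k C C' hC CC' x|k C].
  - exact: qform_bounded.
  - by apply: le_trans (hC x) _; rewrite ler_wpM2r// qform1_ge0.
  - by rewrite Rp_per.
have l2_le d (v : nat -> 'cV[K]_d) N : in_l2 v ->
    \sum_(j < N) qform 1%:M (v j.+1) <=
    limn (series (fun j => norm2 (v j.+1) ^+ 2)).
  move=> vl2; rewrite -(big_mkord xpredT (fun j => qform 1%:M (v j.+1))).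
  under eq_bigr do rewrite -sqnormE.
  apply: (nondecreasing_cvgn_le _ vl2).
  by apply: nondecreasing_series => *; exact: sqr_ge0.
pose w j := B (vartheta h j) *m u j.
exists (post_jump A t x0 w), (fun j => u j.+1).
exists (cQ * limn (series (fun j => norm2 (state h A B t u x0 (t j.+1)) ^+ 2)) +
        cR * limn (series (fun j => norm2 (u j.+1) ^+ 2))).
split=> // N; rewrite big_split /=; apply: lerD.
  apply: le_trans (ler_wpM2l (ltW cQ0) (l2_le _ _ N xl2)).
  rewrite mulr_sumr; apply: ler_sum => j _; have [_ tS _] := ht.
  by rewrite (state_flow A ht B x0 u (j := j)) ?tS ?lexx//; exact: hQ.
apply: le_trans (ler_wpM2l (ltW cR0) (l2_le _ _ N ul2)).
by rewrite mulr_sumr; apply: ler_sum => j _; exact: hR.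
Qed.

End Weights.

(** The control generated by a stabilizing feedback is admissible. *)
Lemma stabilizable_admissible : stabilizable h A B t ->
  forall x0, admissible h A B t x0 !=set0.
Proof.
move=> [F [M [mu [M0 mu0 stab]]]] x0.
pose Fp k := F (vartheta h k.+1).
pose y := fix y j := if j is j'.+1 then
  E j' *m y j' + Bp j' *m (Fp j' *m (E j' *m y j')) else x0.
pose u j := if j is j'.+1 then Fp j' *m (E j' *m y j') else 0.
pose w j := B (vartheta h j) *m u j.
pose x := state h A B t u x0.
have [t0 tS _] := ht.
have yE j : post_jump A t x0 w j = y j.
  by elim: j => [//|j IH]; rewrite post_jumpS IH.
have xt j : x (t j.+1) = E j *m y j.
  by rewrite /x (state_flow A ht B x0 u (j := j)) ?tS ?lexx// -yE.
have uE j : u j.+1 = Fp j *m x (t j.+1) by rewrite xt.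
have x00 : x 0 = x0 by exact: state0.
have xsol : impulse_solution A t
    (fun j => (B (vartheta h j) *m F (vartheta h j)) *m x (t j)) x.
  have [d1 d2 d3 d4] := state_impulse_solution A h_gt0 ht B x0 u.
  split=> // -[//|j] j0.
  by have := d4 _ j0; rewrite uE -/x mulmxA.
have [delta delta0 hdelta] := impulse_times_gap_ge h_gt0 ht.
pose q := expR (- (2 * mu * delta)).
have q01 : `|q| < 1.
  by rewrite ger0_norm ?expR_ge0// expR_lt1 oppr_lt0 !mulr_gt0.
have xdec j : norm2 (x (t j.+1)) ^+ 2 <= geometric (M ^+ 2 * norm2 x0 ^+ 2) q j.
  have tj0 : 0 <= t j.+1 by rewrite -t0 (impulse_times_le ht).
  have := stab x xsol _ tj0; rewrite x00 => hx.
  have hx2 : norm2 (x (t j.+1)) ^+ 2 <=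
      (M * expR (- mu * t j.+1) * norm2 x0) ^+ 2.
    rewrite ler_pXn2r// nnegrE ?sqrtr_ge0//.
    by rewrite !mulr_ge0 ?sqrtr_ge0 ?expR_ge0// ltW.
  apply: le_trans hx2 _; rewrite /geometric /= !exprMn mulrAC.
  have c0 : 0 <= M ^+ 2 * norm2 x0 ^+ 2 by apply: mulr_ge0; exact: sqr_ge0.
  rewrite ler_wpM2l// -!expRM_natl ler_expR.
  have tge := impulse_times_ge ht j.+1 hdelta.
  have : delta * j%:R <= t j.+1.
    by apply: le_trans tge; rewrite ler_pM2l// ler_nat.
  nra.
have xl2 : in_l2 (fun j => x (t j)).
  apply: series_le_cvg (is_cvg_geometric_series q01) => // j.
    exact: sqr_ge0.
  by apply: le_trans (xdec j); exact: sqr_ge0.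
exists u; split=> //.
have [c c0 hc] : exists2 C, 0 < C &
    forall k v, qform 1%:M (Fp k *m v) <= C * qform 1%:M v.
  apply: (periodic_uniform_bound h_gt0) => [k|k C C' hC CC' v|k C].
  - have [C C0 hC] := qform_bounded ((Fp k)^T *m 1%:M *m Fp k).
    by exists C => // v; rewrite -qform_congr.
  - by apply: le_trans (hC v) _; rewrite ler_wpM2r// qform1_ge0.
  - by rewrite /Fp !varthetaS// modnDr.
apply: series_le_cvg (is_cvg_seriesZ (k := c) xl2) => j.
- exact: sqr_ge0.
- by rewrite mulr_ge0 ?sqr_ge0// ltW.
- rewrite -[leRHS]/(c * norm2 (x (t j.+1)) ^+ 2) uE !sqnormE; exact: hc.
Qed.

End ImpulseRiccati.

Lemma periodic_weights1 (K : realType) d h :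
  periodic_weights h (fun=> 1%:M : 'M[K]_d).
Proof.
split=> //; first by exists `|1%:M : 'M[K]_d|.
move=> j _; split=> [|x x0]; first exact: trmx1.
by rewrite -[ltRHS]/(qform _ x) lt_def qform1_eq0 x0 qform1_ge0.
Qed.

Theorem theorem1p1 (K : realType) (n m h : nat)
    (n_gt0 : (0 < n)%N) (m_gt0 : (0 < m)%N) (h_gt0 : (0 < h)%N)
    (A : 'M[K]_n) (B : nat -> 'M[K]_(n, m)) (t : nat -> K)
    (ht : impulse_times h t) :
  [<-> stabilizable h A B t;
       forall x0 : 'cV[K]_n, admissible h A B t x0 !=set0;
       forall (Q : nat -> 'M[K]_n) (R : nat -> 'M[K]_m),
         periodic_weights h Q -> periodic_weights h R ->
         riccati_unique_solution h A B t Q R;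
       exists (Q : nat -> 'M[K]_n) (R : nat -> 'M[K]_m),
         [/\ periodic_weights h Q, periodic_weights h R &
             riccati_unique_solution h A B t Q R]] /\
  ([\/ stabilizable h A B t,
       forall x0 : 'cV[K]_n, admissible h A B t x0 !=set0,
       forall (Q : nat -> 'M[K]_n) (R : nat -> 'M[K]_m),
         periodic_weights h Q -> periodic_weights h R ->
         riccati_unique_solution h A B t Q R |
       exists (Q : nat -> 'M[K]_n) (R : nat -> 'M[K]_m),
         [/\ periodic_weights h Q, periodic_weights h R &
             riccati_unique_solution h A B t Q R]] ->
   forall (Q : nat -> 'M[K]_n) (R : nat -> 'M[K]_m) (P : nat -> 'M[K]_n),
     periodic_weights h Q -> periodic_weights h R ->
     riccati_solution h A B t Q R P ->
     closed_loop_stable h A B t (riccati_feedback B R P)).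
Proof.
split; last by move=> _ Q R P Qw Rw; exact: riccati_feedback_stable.
tfae.
- exact: stabilizable_admissible.
- move=> adm Q R Qw Rw; apply: riccati_unique => //.
  exact: admissible_finite_cost.
- move=> h3; exists (fun=> 1%:M), (fun=> 1%:M).
  by split; [exact: periodic_weights1..|apply: h3; exact: periodic_weights1].
- move=> [Q [R [Qw Rw [P [Psol _]]]]].
  by exists (riccati_feedback B R P); exact: riccati_feedback_stable Psol.
Qed.
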